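(* Assume that: (i) $(\varepsilon_t)$ and $(\eta_t)$ are mutually independent strong white noises with $\mathbb{E}[\ln^+|\varepsilon_0|]<\infty$ and $\mathbb{E}[\ln|\theta+\alpha\,\eta_0+\eta_1|]<0$; (ii) $\sigma_{2k+1}=\tau_{2k+1}=0$ for any $k\in\mathbb{N}$ such that the moments exist; (iii) $\sigma_2>0$, $\tau_2>0$, $\sigma_2<\infty$, $\tau_4<\infty$ and $\rho(M)<1$; and $2\alpha\tau_2\ne1$. Let $$\hat\theta_n=\frac{\sum_{t=1}^nX_{t-1}X_t}{\sum_{t=1}^nX_{t-1}^2},\qquad\hat\varepsilon_t=X_t-\hat\theta_nX_{t-1}\ (1\le t\le n),\qquad\hat\sigma_{2,n}=\frac1n\sum_{t=1}^n\hat\varepsilon_t^{\,2}.$$ Then, as $n\to\infty$, $$\hat\sigma_{2,n}\longrightarrow\sigma_2^*=\big(1-(\theta^* )^2\big)\gamma_X(0)\quad\text{almost surely},\qquad\text{where }\theta^*=\frac{\theta}{1-2\alpha\tau_2}.$$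
   Context: $\theta,\alpha\in\mathbb{R}$ are fixed parameters; $(\varepsilon_t)_{t\in\mathbb{Z}}$, $(\eta_t)_{t\in\mathbb{Z}}$ are real random sequences; $\sigma_a=\mathbb{E}[\varepsilon_0^{\,a}]$, $\tau_a=\mathbb{E}[\eta_0^{\,a}]$. A strong white noise is an i.i.d. sequence; $\ln^+x=\max(\ln x,0)$; $\rho(\cdot)$ is the spectral radius. The process satisfies $X_t=\theta_tX_{t-1}+\varepsilon_t$, $\theta_t=\theta+\alpha\,\eta_{t-1}+\eta_t$, and is observed at times $0,\ldots,n$, with $X_0$ having the strictly stationary and ergodic distribution; that is, $(X_t)$ is the causal strictly stationary ergodic solution $X_t=\varepsilon_t+\sum_{k\ge1}\varepsilon_{t-k}\prod_{\ell=0}^{k-1}\theta_{t-\ell}$ (which exists under (i)). $$M=\begin{pmatrix}\theta^2+\tau_2&2\alpha\theta&\alpha^2\\2\theta\tau_2&2\alpha\tau_2&0\\\theta^2\tau_2+\tau_4&2\alpha\theta\tau_2&\alpha^2\tau_2\end{pmatrix}.$$ $\gamma_X$ is the autocovariance function of the stationary process $(X_t)$; $\gamma_X(0)$ is its variance, explicitly the first entry of $\sigma_2(I_3-M)^{-1}(1,0,\tau_2)^T$. *)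

(* Defs.v *)
From HB Require Import structures.
From mathcomp Require Import all_boot all_order all_algebra.
From mathcomp Require Import all_classical all_reals all_analysis.
From mathcomp Require Import complex.

Set Implicit Arguments.
Unset Strict Implicit.
Unset Printing Implicit Defensive.

Import Order.TTheory GRing.Theory Num.Theory.
Import numFieldNormedType.Exports.

Local Open Scope classical_set_scope.
Local Open Scope ring_scope.

Definition mutually_independent d (T : measurableType d) (R : realType)
    (P : probability T R) (I : choiceType) (Y : I -> {RV P >-> R}) : Prop :=
  forall (s : seq I) (A : I -> set R), uniq s -> (forall i, measurable (A i)) ->
    P (\bigcap_(i in [set` s]) (Y i @^-1` A i)) =
    (\prod_(i <- s) P (Y i @^-1` A i))%E.

Definition identically_distributed d (T : measurableType d) (R : realType)
    (P : probability T R) (I : Type) (Y : I -> {RV P >-> R}) : Prop :=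
  forall (i j : I) (A : set R), measurable A ->
    distribution P (Y i) A = distribution P (Y j) A.

Definition strong_white_noise d (T : measurableType d) (R : realType)
    (P : probability T R) (Y : int -> {RV P >-> R}) : Prop :=
  mutually_independent Y /\ identically_distributed Y.

Definition sigma_of_process d (T : measurableType d) (R : realType)
    (P : probability T R) (I : Type) (Y : I -> {RV P >-> R}) : set (set T) :=
  <<s [set B | exists i : I, exists2 A : set R,
         measurable A & B = Y i @^-1` A] >>.

Definition independent_processes d (T : measurableType d) (R : realType)
    (P : probability T R) (I J : Type)
    (Y : I -> {RV P >-> R}) (Z : J -> {RV P >-> R}) : Prop :=
  forall A B : set T, sigma_of_process Y A -> sigma_of_process Z B ->
    P (A `&` B) = (P A * P B)%E.

(* Extended-real valued; meaningful when a is even, or when Y ^ a is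
   integrable. *)
Definition moment d (T : measurableType d) (R : realType)
    (P : probability T R) (Y : {RV P >-> R}) (a : nat) : \bar R :=
  'E_P[(fun w => Y w ^+ a)%R]%E.

Definition odd_moments_vanish d (T : measurableType d) (R : realType)
    (P : probability T R) (Y : {RV P >-> R}) : Prop :=
  forall k : nat,
    P.-integrable setT (EFin \o (fun w => Y w ^+ (2 * k + 1)%N)) ->
    moment Y (2 * k + 1)%N = 0%E.

Definition spectral_radius (R : realType) (n : nat) (A : 'M[R]_n) : R :=
  sup [set Normc.normc z | z in
        [set z : R[i] | eigenvalue (map_mx (real_complex R) A) z]].

Definition mxM (R : realType) (theta alpha tau2 tau4 : R) : 'M[R]_3 :=
  \matrix_(i < 3, j < 3) nth 0 (nth [::]
    [:: [:: theta ^+ 2 + tau2; 2 * alpha * theta; alpha ^+ 2];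
        [:: 2 * theta * tau2; 2 * alpha * tau2; 0];
        [:: theta ^+ 2 * tau2 + tau4; 2 * alpha * theta * tau2;
            alpha ^+ 2 * tau2]] i) j.

Definition random_coef d (T : measurableType d) (R : realType)
    (P : probability T R) (theta alpha : R) (eta : int -> {RV P >-> R})
    (t : int) (w : T) : R :=
  theta + alpha * eta (t - 1) w + eta t w.

(* The series representation pins X down almost surely; strict stationarity
   and ergodicity are consequences of it and are not assumed. *)
Definition causal_solution d (T : measurableType d) (R : realType)
    (P : probability T R) (theta alpha : R)
    (eps eta X : int -> {RV P >-> R}) : Prop :=
  (forall t : int, {ae P, forall w : T,
     X t w = random_coef theta alpha eta t w * X (t - 1) w + eps t w}) /\
  (forall t : int, {ae P, forall w : T,
     (eps t w + \sum_(1 <= k < m) eps (t - k%:Z) w *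
        \prod_(0 <= l < k) random_coef theta alpha eta (t - l%:Z) w)
     @[m --> \oo] --> X t w}).

Definition autocovariance d (T : measurableType d) (R : realType)
    (P : probability T R) (X : int -> {RV P >-> R}) (h : int) : R :=
  fine (covariance P (X 0) (X h)).

Definition theta_hat (T : Type) (R : realType) (X : int -> T -> R)
    (n : nat) (w : T) : R :=
  (\sum_(1 <= t < n.+1) X (t%:Z - 1) w * X t%:Z w) /
  (\sum_(1 <= t < n.+1) X (t%:Z - 1) w ^+ 2).

Definition residual (T : Type) (R : realType) (X : int -> T -> R)
    (n t : nat) (w : T) : R :=
  X t%:Z w - theta_hat X n w * X (t%:Z - 1) w.

Definition sigma2_hat (T : Type) (R : realType) (X : int -> T -> R)
    (n : nat) (w : T) : R :=
  n%:R^-1 * \sum_(1 <= t < n.+1) residual X n t w ^+ 2.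

(* Main.v *)
(* Dividing sums by [n], the residual variance is [c - b ^ 2 / a], where [a], [b] and
   [c] are the sample means of [X_(t-1) ^ 2], [X_(t-1) X_t] and [X_t ^ 2].  On the space
   of all noise trajectories, [X_t] is a fixed functional of the trajectory shifted by
   [t], so Birkhoff's theorem applies: the law of independent coordinates is mixing
   under the shift, hence ergodic.

   The terms [a_k] of the causal series satisfy [a_(k+1) o tau = theta_1 a_k], so the
   vector of the means of [a_k ^ 2], [eta_0 a_k ^ 2], [eta_0 ^ 2 a_k ^ 2] is multiplied
   by [M] at each step and decays geometrically.  This gives [X_0] and [eta_0 X_0] in
   L2 and [E X_0 = 0].  Then [B = E (eta_0 X_0 ^ 2)] satisfies
   [B = 2 tau_2 (theta gamma(0) + alpha B)], while
   [gamma(1) = theta gamma(0) + alpha B], whence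
   [gamma(1) = theta gamma(0) / (1 - 2 alpha tau_2)]. *)

Require Import Defs.
From HB Require Import structures.
From mathcomp Require Import all_boot all_order all_algebra.
From mathcomp Require Import all_classical all_reals all_analysis.
From mathcomp Require Import complex.
From mathcomp Require Import measurable_realfun ring lra.

Set Implicit Arguments.
Unset Strict Implicit.
Unset Printing Implicit Defensive.

Import Order.TTheory GRing.Theory Num.Theory.
Import numFieldNormedType.Exports.

Local Open Scope classical_set_scope.
Local Open Scope ring_scope.

(** The given probability space carries no shift and the series pins [X] down only up to null sets.
    The ergodic argument therefore lives on the space of trajectories under the law of the noises,
    and means and null sets are carried between the two spaces along the map sending an outcome to
    its trajectory.

    The weights 1, eta_0, eta_0^2 close the recursion because consecutive coefficients share a
    noise: theta_1 involves the past only through eta_0, hence theta_1^2 only through eta_0 and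
    eta_0^2. The fourth moment enters because the new weight eta_1^2 meets the eta_1^2 of theta_1^2.

    The recursion controls single terms of the series, not their sum. A decay of order r^k for the
    mean of a_k^2 is read as s^(2k) with s = sqrt r: one factor s^k pays for the weights of a
    Cauchy-Schwarz inequality, the other keeps the result summable. Fatou's lemma then yields the
    existence of the second moments without their values. gamma(0) stays an unknown to which the
    other covariances are tied by stationarity; gamma(0) >= sigma_2 > 0 allows dividing by it. *)

(** * Birkhoff's theorem for ergodic maps *)

Lemma integrable_measurable d (T : measurableType d) (R : realType)
    (mu : {measure set T -> \bar R}) (f : T -> R) :
  mu.-integrable setT (EFin \o f) -> measurable_fun setT f.
Proof. by move=> /measurable_int/measurable_EFinP. Qed.

Section measure_preserving.
Context d1 d2 (T1 : measurableType d1) (T2 : measurableType d2) (R : realType).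
Variables (mu1 : {measure set T1 -> \bar R}) (mu2 : {measure set T2 -> \bar R}).
Variable phi : T1 -> T2.
Hypothesis mphi : measurable_fun setT phi.
Hypothesis pphi : forall A, measurable A -> mu1 (phi @^-1` A) = mu2 A.

Lemma ge0_integral_preserving (f : T2 -> \bar R) :
  measurable_fun setT f -> (forall x, 0 <= f x)%E ->
  (\int[mu1]_x f (phi x) = \int[mu2]_x f x)%E.
Proof.
move=> mf f0.
rewrite -[LHS](ge0_integral_pushforward mphi mu1 measurableT mf (fun x _ => f0 x)).
by apply: eq_measure_integral => A mA _; exact: pphi.
Qed.

Lemma integrable_preserving (f : T2 -> \bar R) :
  mu2.-integrable setT f -> mu1.-integrable setT (f \o phi).
Proof.
move=> /integrableP[mf fi]; apply/integrableP; split.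
  exact: measurableT_comp.
rewrite (@ge0_integral_preserving (fun x => `|f x|%E)) //.
exact: measurableT_comp.
Qed.

Lemma integral_preserving (f : T2 -> \bar R) :
  mu2.-integrable setT f -> (\int[mu1]_x f (phi x) = \int[mu2]_x f x)%E.
Proof.
move=> fi; have mf := measurable_int _ fi.
have fti : mu1.-integrable (phi @^-1` setT) (f \o phi).
  by rewrite preimage_setT; exact: integrable_preserving.
rewrite -[LHS](integral_pushforward mphi mf fti measurableT).
by apply: eq_measure_integral => A mA _; exact: pphi.
Qed.

Lemma Rintegral_preserving (f : T2 -> R) : mu2.-integrable setT (EFin \o f) ->
  \int[mu1]_x f (phi x) = \int[mu2]_x f x.
Proof. by move=> fi; rewrite /Rintegral (integral_preserving fi). Qed.

End measure_preserving.

Section birkhoff.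
Context d (T : measurableType d) (R : realType) (mu : probability T R).
Variable tau : T -> T.
Hypothesis mtau : measurable_fun setT tau.
Hypothesis ptau : forall A, measurable A -> mu (tau @^-1` A) = mu A.

(** The maximum of the Birkhoff sums of lengths 0 to [n], in the recursive form
    [M_(n+1) = max(0, f + M_n o tau)] on which the maximal argument runs. *)
Fixpoint maxsum (f : T -> R) n x : R :=
  if n is m.+1 then Num.max 0 (f x + maxsum f m (tau x)) else 0.

Definition birkhoff_sum (f : T -> R) n x : R := \sum_(i < n) f (iter i tau x).

Lemma maxsum_ge0 f n x : 0 <= maxsum f n x.
Proof. by case: n => [|n] //=; rewrite le_max lexx. Qed.

Lemma maxsum_nd f n x : maxsum f n x <= maxsum f n.+1 x.
Proof.
elim: n x => [|n IH] x; first exact: (maxsum_ge0 f 1).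
rewrite [maxsum f n.+1 x]/= [maxsum f n.+2 x]/= ge_max !le_max lexx /=.
by rewrite lerD2l IH orbT.
Qed.

Lemma maxsum_homo f x : {homo (fun n => maxsum f n x) : m n / (m <= n)%N >-> m <= n}.
Proof. by apply: homo_leq => // [y|n]; [exact: le_trans|exact: maxsum_nd]. Qed.

Lemma birkhoff_sumS f n x :
  birkhoff_sum f n.+1 x = f x + birkhoff_sum f n (tau x).
Proof.
rewrite /birkhoff_sum big_ord_recl /=; congr (_ + _).
by apply: eq_bigr => i _; rewrite /= -iterSr iterS.
Qed.

Lemma birkhoff_sum_le_maxsum f n x : birkhoff_sum f n x <= maxsum f n x.
Proof.
elim: n x => [|n IH] x; first by rewrite /birkhoff_sum big_ord0.
by rewrite birkhoff_sumS /= le_max lerD2l IH orbT.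
Qed.

Lemma measurable_maxsum f n :
  measurable_fun setT f -> measurable_fun setT (maxsum f n).
Proof.
move=> mf; elim: n => [|n IH] /=; first exact: measurable_cst.
apply: measurable_maxr; first exact: measurable_cst.
by apply: measurable_funD => //; exact: (measurableT_comp IH).
Qed.

Lemma integrable_maxsum f n : mu.-integrable setT (EFin \o f) ->
  mu.-integrable setT (EFin \o maxsum f n).
Proof.
move=> fi; have mf : measurable_fun setT f := integrable_measurable fi.
elim: n => [|n IH]; first exact: (finite_measure_integrable_cst mu 0).
have IH' : mu.-integrable setT (EFin \o (fun x => f x + maxsum f n (tau x))).
  rewrite (_ : _ \o _ = ((EFin \o f) \+ ((EFin \o maxsum f n) \o tau))%E) //.
  by apply: integrableD => //; exact: (integrable_preserving mtau ptau IH).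
apply: le_integrable IH' => //.
  by apply/measurable_EFinP; exact: (measurable_maxsum n.+1).
move=> x _ /=; rewrite lee_fin.
by rewrite ger0_norm ?le_max ?lexx // ge_max normr_ge0 ler_norm.
Qed.

(** The maximal sums are nondecreasing in [n], so this is where they diverge, that is, where the
    Birkhoff sums are not bounded above. *)
Definition unbounded_sums f : set T :=
  \bigcap_k \bigcup_n [set x | k%:R < maxsum f n x].

Lemma measurable_unbounded_sums f : measurable_fun setT f ->
  measurable (unbounded_sums f).
Proof.
move=> mf; apply: bigcapT_measurable => k; apply: bigcupT_measurable => n.
rewrite -[X in measurable X]setTI (_ : [set x | _] = maxsum f n @^-1` `]k%:R, +oo[).
  by apply: (measurable_maxsum n mf) => //; exact: measurable_itv.
by apply/seteqP; split => x /=; rewrite in_itv /= andbT.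
Qed.

(** [maxsum f n.+1 x] and [maxsum f n (tau x)] differ by at most [|f x|], so they are unbounded
    together; rounding [|f x|] up to an integer absorbs the difference. The equality of sets is
    exact, which is the form of invariance that the ergodicity hypothesis asks for. *)
Lemma unbounded_sums_inv f : tau @^-1` unbounded_sums f = unbounded_sums f.
Proof.
apply/seteqP; split => x /= h k _.
- have [n _ /= hn] := h (k + Num.truncn `|f x|).+1 I.
  exists n.+1 => //=; rewrite lt_max; apply/orP; right.
  have : `|f x| < (Num.truncn `|f x|).+1%:R by rewrite truncnS_gt.
  move: hn; rewrite -addnS natrD => h1 h2.
  have := ler_norm (- f x); rewrite normrN => h3; lra.
- have [n _ /= hn] := h (k + Num.truncn `|f x|).+1 I.
  exists n => //=; have : maxsum f n x <= maxsum f n.+1 x := maxsum_nd f n x.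
  have : `|f x| < (Num.truncn `|f x|).+1%:R by rewrite truncnS_gt.
  move: hn; rewrite /= -addnS natrD => h1 h2.
  have := ler_norm (f x); have : 0 <= k%:R :> R by [].
  by have := normr_ge0 (f x); case: (lerP 0 (f x + maxsum f n (tau x))) => ? ? ? ? ?; lra.
Qed.

(* On the set where the maximal sums are unbounded,
   [M_(n+1) - M_n o tau = max (- M_n o tau) f] is eventually equal to [f], while
   its integral [\int M_(n+1) - \int M_n] is nonnegative. *)
Lemma integral_unbounded_sums f : mu.-integrable setT (EFin \o f) ->
  mu (unbounded_sums f) = 1%E -> (0 <= \int[mu]_x (f x)%:E)%E.
Proof.
move=> fi muA; have mf : measurable_fun setT f := integrable_measurable fi.
pose D n x : R := maxsum f n.+1 x - maxsum f n (tau x).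
have mD n : measurable_fun setT (D n).
  apply: measurable_funB; first exact: measurable_maxsum.
  by apply: (measurableT_comp _ mtau); exact: measurable_maxsum.
have iD n : mu.-integrable setT (EFin \o D n).
  rewrite (_ : _ \o _ = ((EFin \o maxsum f n.+1) \- ((EFin \o maxsum f n) \o tau))%E) //.
  apply: integrableB => //; first exact: integrable_maxsum.
  by exact: (integrable_preserving mtau ptau (integrable_maxsum n fi)).
have D0 n : (0 <= \int[mu]_x (D n x)%:E)%E.
  rewrite (_ : (\int[mu]_x _)%E = (\int[mu]_x (maxsum f n.+1 x)%:E -
     \int[mu]_x (maxsum f n (tau x))%:E)%E); last first.
    apply: integralB_EFin => //; first exact: integrable_maxsum.
    exact: (integrable_preserving mtau ptau (integrable_maxsum n fi)).
  rewrite (integral_preserving mtau ptau (integrable_maxsum n fi)).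
  rewrite sube_ge0; last first.
    exact/orP/or_introl/(integrable_fin_num _ (integrable_maxsum n fi)).
  apply: le_integral => //; do ?exact: integrable_maxsum.
  by move=> x _; rewrite lee_fin maxsum_nd.
have [] := @dominated_convergence _ _ _ mu setT measurableT
   (fun n => EFin \o D n) (EFin \o f) (EFin \o (fun x => `|f x|)).
- by move=> n; exact/measurable_EFinP.
- exact/measurable_EFinP.
- exists (~` unbounded_sums f); split.
  + exact/measurableC/measurable_unbounded_sums.
  + have := probability_setC mu (measurable_unbounded_sums mf).
    by rewrite muA subee.
  + move=> x /= h Ax; apply: h => _; rewrite -[unbounded_sums f]unbounded_sums_inv in Ax.
    have [N _ /= hN] := Ax (Num.truncn `|f x|).+1 I.
    apply: cvg_near_cst; near=> n; congr EFin; rewrite /D /=.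
    have : maxsum f N (tau x) <= maxsum f n (tau x).
      by apply: maxsum_homo; near: n; exact: nbhs_infty_ge.
    have : `|f x| < (Num.truncn `|f x|).+1%:R by rewrite truncnS_gt.
    have := ler_norm (- f x); rewrite normrN => h1 h2 h3.
    by rewrite max_r; [|]; lra.
- exact: integrable_norm.
(* For [y >= 0] the number [max(-y, f)] lies between [-|f|] and [|f|], whence the domination. *)
- apply: aeW => x n _ /=; rewrite lee_fin /D /=.
  have := maxsum_ge0 f n (tau x); have := ler_norm (f x).
  have := ler_norm (- f x); rewrite normrN => h1 h2 h3.
  by rewrite ler_norml; case: (lerP 0 (f x + maxsum f n (tau x))) => ?; lra.
move=> _ _ cD.
rewrite -(cvg_lim _ cD) //.
by apply: lime_ge; [apply/cvg_ex; eexists; exact: cD|apply: nearW => n; exact: D0].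
Unshelve. all: by end_near. Qed.

Hypothesis ergodic : forall A, measurable A -> tau @^-1` A = A ->
  mu A = 0%E \/ mu A = 1%E.

(** The divergence set is invariant, hence of mass 0 or 1, and mass 1 would force a nonnegative
    integral. *)
Lemma birkhoff_sum_bounded f : mu.-integrable setT (EFin \o f) ->
  (\int[mu]_x (f x)%:E < 0)%E ->
  {ae mu, forall x, exists K : R, forall n, birkhoff_sum f n x <= K}.
Proof.
move=> fi flt0; have mf : measurable_fun setT f := integrable_measurable fi.
exists (unbounded_sums f); split.
- exact: measurable_unbounded_sums.
- have [//|h] := ergodic (measurable_unbounded_sums mf) (unbounded_sums_inv f).
  by have := integral_unbounded_sums fi h; rewrite leNgt flt0.
- move=> x /= h; apply: contrapT => Ax; apply: h.
  have [k hk] : exists k : nat, forall n, maxsum f n x <= k%:R.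
    apply: contrapT => hk; apply: Ax => k _; apply: contrapT => hn.
    apply: hk; exists k => n; rewrite leNgt; apply/negP => kn; apply: hn.
    by exists n.
  by exists k%:R => n; apply: le_trans (hk n); exact: birkhoff_sum_le_maxsum.
Qed.

Lemma birkhoff_limsup f (e : R) : mu.-integrable setT (EFin \o f) -> 0 < e ->
  {ae mu, forall x, \forall n \near \oo,
     n%:R^-1 * birkhoff_sum f n x <= \int[mu]_x f x + e}.
Proof.
(* Centering at the mean plus [e / 2] makes the integral negative, so the centered sums stay below
   some [K]; the other [e / 2] absorbs [K / n]. *)
move=> fi e0; pose c := \int[mu]_x f x + e / 2.
have ci : mu.-integrable setT (EFin \o (fun=> c : R)) := finite_measure_integrable_cst mu c measurableT.
have gi : mu.-integrable setT (EFin \o (f \- cst c)%R).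
  rewrite (_ : _ \o _ = ((EFin \o f) \- (EFin \o (fun=> c)))%E) //.
  exact: integrableB.
have : (\int[mu]_x ((f \- cst c)%R x)%:E < 0)%E.
  rewrite integralB_EFin //= integral_cst //= probability_setT mule1.
  rewrite -[X in (X - _)%E]fineK; last exact: (integrable_fin_num _ fi).
  by rewrite -EFinB lte_fin /c /Rintegral opprD addNKr oppr_lt0 divr_gt0.
move=> /(birkhoff_sum_bounded gi); apply: filterS => x [K hK].
near=> n; have n0 : (0 < n)%N by near: n; exact: nbhs_infty_gt.
have nK : K <= n%:R * (e / 2).
  rewrite -ler_pdivrMr ?divr_gt0 //; near: n; exact: nbhs_infty_ger.
have n0' : 0 < n%:R :> R by rewrite ltr0n.
rewrite mulrC ler_pdivrMr //.
have := hK n; rewrite /birkhoff_sum /= sumrB sumr_const card_ord -mulr_natl /c.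
by move=> h; rewrite mulrC; lra.
Unshelve. all: by end_near. Qed.

Theorem birkhoff f : mu.-integrable setT (EFin \o f) ->
  {ae mu, forall x, n%:R^-1 * birkhoff_sum f n x @[n --> \oo] --> \int[mu]_x f x}.
Proof.
move=> fi.
have nfi : mu.-integrable setT (EFin \o (fun x => - f x)) by have := integrableN fi.
have intN : \int[mu]_x (- f x) = - \int[mu]_x f x.
  rewrite /Rintegral; under eq_integral do rewrite EFinN.
  by rewrite integralN ?fineN //; exact: integrable_add_def.
(* Errors [1 / (k + 1)] keep the union of the exceptional sets countable; the lower bound is the
   upper bound for [- f]. *)
have h1 : {ae mu, forall x, forall k : nat, \forall n \near \oo,
     n%:R^-1 * birkhoff_sum f n x <= \int[mu]_x f x + k.+1%:R^-1}.
  by apply: ae_foralln => k; apply: birkhoff_limsup; rewrite ?invr_gt0.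
have h2 : {ae mu, forall x, forall k : nat, \forall n \near \oo,
     n%:R^-1 * birkhoff_sum (fun x => - f x) n x <= \int[mu]_x (- f x) + k.+1%:R^-1}.
  by apply: ae_foralln => k; apply: birkhoff_limsup; rewrite ?invr_gt0.
apply: filterS2 h1 h2 => x h1 h2; apply/cvgrPdist_le => /= e e0.
have [k ke] : exists k : nat, k.+1%:R^-1 <= e.
  exists (Num.truncn e^-1); rewrite invf_ple ?posrE //.
  by rewrite ltW // truncnS_gt.
have := h1 k; have := h2 k; apply: filterS2 => n.
rewrite intN /birkhoff_sum sumrN mulrN => k2 k1.
have aux (a b c u : R) : a <= b + c -> - a <= - b + c -> c <= u -> `|b - a| <= u.
  by move=> ? ? ?; rewrite ler_norml; apply/andP; split; lra.
exact: aux k1 k2 ke.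
Qed.

End birkhoff.

(** * Mixing on a generating pi-system implies ergodicity *)

Section mixing.
Context d (T : measurableType d) (R : realType) (mu : probability T R).
Variable tau : T -> T.
Hypothesis mtau : measurable_fun setT tau.
Hypothesis ptau : forall A, measurable A -> mu (tau @^-1` A) = mu A.

Local Notation prb A := (fine (mu A)).

Lemma prbK A : measurable A -> (prb A)%:E = mu A.
Proof. by move=> mA; rewrite fineK // fin_num_measure. Qed.

Lemma prb_setU A B : measurable A -> measurable B -> A `&` B = set0 ->
  prb (A `|` B) = prb A + prb B.
Proof.
move=> mA mB AB; rewrite measureU // fineD // fin_num_measure //.
Qed.

Lemma prb_le A B : measurable A -> measurable B -> A `<=` B -> prb A <= prb B.
Proof.
move=> mA mB AB; rewrite -lee_fin !prbK //.
by apply: le_measure => //; rewrite inE.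
Qed.

Lemma prb_le1 A : measurable A -> prb A <= 1.
Proof. by move=> mA; rewrite -lee_fin prbK // probability_le1. Qed.

Lemma measurable_iter n A : measurable A -> measurable (iter n tau @^-1` A).
Proof.
move=> mA; elim: n => [|n IH] //.
have -> : iter n.+1 tau @^-1` A = tau @^-1` (iter n tau @^-1` A).
  by apply/seteqP; split => x /=; rewrite -iterSr iterS.
by rewrite -[X in measurable X]setTI; exact: mtau.
Qed.

Lemma measure_iter_preserving n A : measurable A ->
  mu (iter n tau @^-1` A) = mu A.
Proof.
move=> mA; elim: n => [|n IH] //.
have -> : iter n.+1 tau @^-1` A = tau @^-1` (iter n tau @^-1` A).
  by apply/seteqP; split => x /=; rewrite -iterSr iterS.
by rewrite ptau //; exact: measurable_iter.
Qed.

Lemma prb_setID A E : measurable A -> measurable E ->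
  prb A = prb (A `&` E) + prb (A `&` ~` E).
Proof.
move=> mA mE; rewrite -prb_setU; first by rewrite -setIUr setUv setIT.
- exact: measurableI.
- by apply: measurableI => //; exact: measurableC.
- by rewrite setIACA setICr setI0.
Qed.

Variable G : set (set T).
Hypothesis mG : @measurable _ T = <<s G >>.
Hypothesis GI : setI_closed G.
Hypothesis GT : G setT.
Hypothesis mix : forall A B, G A -> G B ->
  \forall n \near \oo, mu (A `&` iter n tau @^-1` B) = (mu A * mu B)%E.

Let Gm A : G A -> measurable A.
Proof. by move=> GA; rewrite mG; exact: sub_sigma_algebra. Qed.

(** A Dynkin argument on [D] with [B] fixed in [G]: complements use the invariance of [mu], and
    countable disjoint unions are cut to finite ones with a tail that is small uniformly in [n]. *)
Lemma mixing_measurable B D : G B -> measurable D ->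
  prb (D `&` iter n tau @^-1` B) @[n --> \oo] --> prb D * prb B.
Proof.
move=> GB; have mB := Gm GB.
have mE n : measurable (iter n tau @^-1` B) := measurable_iter n mB.
rewrite mG; move: D; apply: dynkin_induction => //.
- rewrite probability_setT mul1r; apply: cvg_near_cst; apply: nearW => n.
  by rewrite setTI measure_iter_preserving.
- move=> A GA; apply: cvg_near_cst; have := mix GA GB; apply: filterS => n ->.
  by rewrite fineM // fin_num_measure //; exact: Gm.
- move=> D mD cD.
  have -> : (fun n => prb (~` D `&` iter n tau @^-1` B)) =
            (fun n => prb B - prb (D `&` iter n tau @^-1` B)).
    apply/funext => n; rewrite -(measure_iter_preserving n mB).
    by rewrite (prb_setID (mE n) mD) setIC [D `&` _]setIC addrAC subrr add0r.
  have -> : prb (~` D) * prb B = prb B - prb D * prb B.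
    rewrite probability_setC // fineB ?fin_num_measure //= mulrBl mul1r //.
  exact: cvgB (cvg_cst _) cD.
- move=> F mF tF cF.
  pose U := \bigcup_k F k; pose H K := \big[setU/set0]_(k < K) F k.
  have mU : measurable U by exact: bigcupT_measurable.
  have mH K : measurable (H K) by exact: bigsetU_measurable.
  have HU K : H K `<=` U by rewrite /H -bigcup_mkord; apply: bigcup_sub => k _ x; exists k.
  have cH K : prb (H K `&` iter n tau @^-1` B) @[n --> \oo] --> prb (H K) * prb B.
    elim: K => [|K IH].
      rewrite /H big_ord0; apply: cvg_near_cst; apply: nearW => n.
      by rewrite set0I measure0 mul0r.
    have HF : H K `&` F K = set0.
      rewrite /H -bigcup_mkord; apply/seteqP; split => // x [[k /= kK Fkx] FKx].
      have := @trivIsetP _ _ setT F; move=> [/(_ tF) + _].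
      move=> /(_ k K I I); rewrite (ltn_eqF kK) => /(_ isT) h.
      by have : (F k `&` F K) x by []; rewrite h.
    have HS : H K.+1 = H K `|` F K by rewrite /H big_ord_recr.
    rewrite HS prb_setU // mulrDl.
    have -> : (fun n => prb ((H K `|` F K) `&` iter n tau @^-1` B)) =
      (fun n => prb (H K `&` iter n tau @^-1` B) + prb (F K `&` iter n tau @^-1` B)).
      apply/funext => n; rewrite setIUl prb_setU //; do ?exact: measurableI.
      by rewrite setIACA HF set0I.
    exact: cvgD IH (cF K).
  have cHU : prb (H K) @[K --> \oo] --> prb U.
    apply: fine_cvg; rewrite prbK //.
    have -> : U = \bigcup_K H K.
      apply/seteqP; split => x [k _ hx]; last exact: HU hx.
      by exists k.+1 => //; rewrite /H big_ord_recr /=; right.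
    apply: nondecreasing_cvg_mu => //; first exact: bigcupT_measurable.
    move=> m n mn; rewrite /H -!bigcup_mkord; apply/subsetPset.
    by apply: bigcup_sub => k /= km x; exists k => //=; exact: leq_trans km mn.
  have b1 := prb_le1 mB; have b0 : 0 <= prb B by rewrite fine_ge0.
  apply/cvgrPdist_le => /= e e0.
  have e3 : 0 < e / 3 by rewrite divr_gt0.
  (* The part of [U] outside [H K] has mass at most [e / 3], whatever [n] is; this bounds the change
     of the intersection and of the product alike. *)
  have [K hK] : exists K, prb U - prb (H K) <= e / 3.
    have /cvgrPdist_le /(_ _ e3) [K _ hK] := cHU; exists K.
    have := hK K (leqnn K); exact/le_trans/ler_norm.
  have := cH K; move=> /cvgrPdist_le /(_ _ e3); apply: filterS => n /=.
  rewrite !ler_norml => /andP[l1 l2].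
  have w1 : prb (H K `&` iter n tau @^-1` B) <= prb (U `&` iter n tau @^-1` B).
    by apply: prb_le; [exact: measurableI|exact: measurableI|exact: setSI].
  have w2 : prb (U `&` iter n tau @^-1` B) <=
      prb (H K `&` iter n tau @^-1` B) + (prb U - prb (H K)).
    have UE : H K `&` ~` (iter n tau @^-1` B) `<=` U `&` ~` (iter n tau @^-1` B) by exact: setSI.
    have := prb_le (measurableI _ _ (mH K) (measurableC (mE n)))
      (measurableI _ _ mU (measurableC (mE n))) UE.
    by have := prb_setID mU (mE n); have := prb_setID (mH K) (mE n); lra.
  have w3 : prb (H K) <= prb U by exact: prb_le.
  have w4 : 0 <= (prb U - prb (H K)) * prb B by rewrite mulr_ge0 // subr_ge0.
  have w5 : (prb U - prb (H K)) * prb B <= prb U - prb (H K).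
    by rewrite ler_piMr // subr_ge0.
  rewrite mulrBl in w4 w5.
  by apply/andP; split; lra.
Qed.

(** For an invariant [A] the mixing sequence is constant, so [A] is independent of every set in [G].
    The finite measures [mu (. & A)] and [mu A * mu] then agree on the pi-system [G], hence
    everywhere; evaluated at [A] itself they give [p = p ^ 2]. *)
Lemma mixing_ergodic A : measurable A -> tau @^-1` A = A ->
  mu A = 0%E \/ mu A = 1%E.
Proof.
move=> mA tA.
have tAn n : iter n tau @^-1` A = A.
  elim: n => [|n IH] //; rewrite -[RHS]tA -[in RHS]IH.
  by apply/seteqP; split => x /=; rewrite -iterSr iterS.
have AB B : G B -> prb (A `&` B) = prb A * prb B.
  move=> GB; have mB := Gm GB; have := mixing_measurable GB mA.
  have -> : (fun n => prb (A `&` iter n tau @^-1` B)) = fun=> prb (A `&` B).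
    apply/funext => n; rewrite -{1}(tAn n) -preimage_setI measure_iter_preserving //.
    exact: measurableI.
  by move=> /(cvg_unique _ (cvg_cst _)) ->.
have r0 : 0 <= prb A by rewrite fine_ge0.
have h D : measurable D -> mu (D `&` A) = (mu A * mu D)%E.
  rewrite {1}mG => mD.
  rewrite -(prbK mA).
  apply: (@g_sigma_algebra_measure_unique _ R T G _ (fun=> setT) _ _
    (mrestr mu mA) (mscale (NngNum r0) mu) GI _ _ D mD) => //.
  - by apply/seteqP; split => // x _; exists 0%N.
  - move=> C GC; have mC := Gm GC; change (mu (C `&` A) = (prb A)%:E * mu C)%E.
    rewrite -(prbK mC) -EFinM -AB // setIC prbK //.
    exact: measurableI.
  - move=> k; change (mu (setT `&` A) < +oo)%E.
    by rewrite setTI ltey_eq fin_num_measure.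
have := h A mA; rewrite setIid -(prbK mA) -EFinM => -[].
move=> /eqP; rewrite -subr_eq0 -{1}[prb A]mulr1 -mulrBr mulf_eq0 => /orP[/eqP->|].
  by left.
by rewrite subr_eq0 => /eqP <-; right.
Qed.

End mixing.

(** * Coordinate spaces and independent coordinates *)

Section coordinate_space.
Context (I : choiceType) (R : realType).

Definition cylinder (s : seq I) (A : I -> set R) : set (I -> R) :=
  [set z | forall i, i \in s -> A i (z i)].

Definition cylinders : set (set (I -> R)) :=
  [set C | exists s A, (forall i, measurable (A i)) /\ C = cylinder s A].

Local Notation Om := (g_sigma_algebraType cylinders).

Lemma cylinder_undup s A : cylinder (undup s) A = cylinder s A.
Proof. by apply/seteqP; split => z h i hi; apply: h; rewrite ?mem_undup // -mem_undup. Qed.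

Lemma cylinders_setI : setI_closed cylinders.
Proof.
move=> _ _ [s [A [mA ->]]] [t [B [mB ->]]].
exists (s ++ t), (fun i => (if i \in s then A i else setT) `&` (if i \in t then B i else setT)); split.
  by move=> i; apply: measurableI; case: ifP.
apply/seteqP; split => z.
  move=> [h1 h2] i _; split; case: ifP => //; [exact: h1|exact: h2].
move=> h; split => i hi; have := h i; rewrite mem_cat hi ?orbT => /(_ isT)[] //.
Qed.

Lemma cylinders_setT : cylinders setT.
Proof. by exists [::], (fun=> setT); split => //; apply/seteqP; split. Qed.

Lemma measurable_cylinder s A : (forall i, measurable (A i)) ->
  measurable (cylinder s A : set Om).
Proof. by move=> mA; apply: sub_sigma_algebra; exists s, A. Qed.

Lemma measurable_coord i : measurable_fun setT (fun z : Om => z i).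
Proof.
move=> _ A mA; rewrite setTI (_ : _ @^-1` _ = cylinder [:: i] (fun=> A)).
  exact: measurable_cylinder.
apply/seteqP; split => z /= h.
  by move=> j; rewrite inE => /eqP ->.
by apply: (h i); rewrite inE.
Qed.

Lemma measurable_coordP d (T : measurableType d) (f : T -> Om) :
  (forall i, measurable_fun setT (fun x => f x i)) -> measurable_fun setT f.
Proof.
move=> mf; apply: (@measurability _ _ T Om setT f cylinders) => // _ [_ [s [A [mA ->]]] <-].
rewrite setTI (_ : _ @^-1` _ = \big[setI/setT]_(i <- s) ((fun x => f x i) @^-1` A i)).
  apply: bigsetI_measurable => i _; rewrite -[X in measurable X]setTI.
  exact: mf.
rewrite -bigcap_seq; apply/seteqP; split => x /= h i hi; exact: h.
Qed.

(** Uniqueness of measures on a pi-system. Repetition-free lists suffice because [undup] does not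
    change a cylinder, and they are the lists to which independence applies. *)
Lemma probability_cylinder_eq (m1 m2 : probability Om R) :
  (forall s A, uniq s -> (forall i, measurable (A i)) ->
     m1 (cylinder s A) = m2 (cylinder s A)) ->
  forall A, measurable A -> m1 A = m2 A.
Proof.
move=> h; apply: (@measure_unique _ R Om cylinders (fun=> setT)) => //.
- exact: cylinders_setI.
- by move=> _; exact: cylinders_setT.
- by apply/seteqP; split => // x _; exists 0%N.
- move=> _ [s [A [mA ->]]]; rewrite -cylinder_undup; apply: h => //.
  exact: undup_uniq.
- by move=> k; rewrite ltey_eq fin_num_measure.
Qed.

End coordinate_space.

Notation coord_space I R := (g_sigma_algebraType (@cylinders I R)).

Section independent_coordinates.
Context (I : choiceType) (R : realType).
Local Notation Om := (coord_space I R).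
Variable mu : probability Om R.
Hypothesis indep : forall (s : seq I) (A : I -> set R), uniq s ->
  (forall i, measurable (A i)) ->
  mu (cylinder s A) = (\prod_(i <- s) mu ((fun z => z i) @^-1` A i))%E.

Section shift.
Variables s s' : I -> I.
Hypothesis sK : cancel s s'.
Hypothesis stat : forall i A, measurable A ->
  mu ((fun z => z (s i)) @^-1` A) = mu ((fun z => z i) @^-1` A).
Hypothesis wandering : forall i j, \forall n \near \oo, iter n s j != i.

Definition shift (z : Om) : Om := z \o s.

Lemma measurable_shift : measurable_fun setT shift.
Proof. by apply: measurable_coordP => i; exact: measurable_coord. Qed.

Lemma iter_shift n z i : iter n shift z i = z (iter n s i).
Proof. by elim: n i => [|n IH] i //; rewrite iterS /shift /= IH -iterSr iterS. Qed.

Let stat_iter n i A : measurable A ->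
  mu ((fun z => z (iter n s i)) @^-1` A) = mu ((fun z => z i) @^-1` A).
Proof. by move=> mA; elim: n => [|n IH] //; rewrite stat. Qed.

Let iterK n : cancel (iter n s) (iter n s').
Proof. by elim: n => [|n IH] i //; rewrite iterSr iterS sK. Qed.

Lemma shift_cylinder n t (B : I -> set R) :
  iter n shift @^-1` cylinder t B =
  cylinder (map (iter n s) t) (fun i => B (iter n s' i)).
Proof.
apply/seteqP; split => z /= h.
  by move=> _ /mapP[j jt ->]; rewrite iterK -iter_shift; exact: h.
by move=> j jt; have := h _ (map_f (iter n s) jt); rewrite iterK iter_shift.
Qed.

(** The preimage of a cylinder is a cylinder over the moved index list, still repetition-free since
    [s] is injective, and [stat] leaves each factor of its mass unchanged. *)
Lemma shift_preserving A : measurable A -> mu (shift @^-1` A) = mu A.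
Proof.
move=> mA.
pose nu := distribution mu (mfun_Sub (mem_set measurable_shift) : {mfun Om >-> Om}).
apply: (@probability_cylinder_eq _ _ nu mu) => // t B ut mB.
rewrite [LHS](_ : _ = mu (iter 1 shift @^-1` cylinder t B)) //.
rewrite shift_cylinder indep; last by move=> i; exact: mB.
  by rewrite big_map indep //; apply: eq_bigr => i _; rewrite iterK stat_iter.
by rewrite map_inj_uniq //; exact: can_inj (iterK 1).
Qed.

(** Iterating [s] takes every index out of a given finite list. For large [n] the two events
    constrain disjoint sets of coordinates, so the product formula is exact and not merely
    asymptotic. *)
Lemma shift_mixing A B : cylinders A -> cylinders B ->
  \forall n \near \oo, mu (A `&` iter n shift @^-1` B) = (mu A * mu B)%E.
Proof.
move=> [u [A' [mA ->]]] [t [B' [mB ->]]].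
rewrite -(cylinder_undup u) -(cylinder_undup t).
move: (undup_uniq u) (undup_uniq t); move: (undup u) (undup t) => {}u {}t uu ut.
have : \forall n \near \oo, all (fun i => all (fun j => iter n s j != i) t) u.
  elim: u {uu} => [|i u IH]; first exact: nearW.
  have hi : \forall n \near \oo, all (fun j => iter n s j != i) t.
    elim: t {ut IH} => [|j t IH]; first exact: nearW.
    by have := wandering i j; apply: filterS2 IH => n /= -> ->.
  by apply: filterS2 hi IH => n /= -> ->.
apply: filterS => n /allP hn.
have dis j : j \in t -> iter n s j \in u = false.
  by move=> jt; apply/negP => /hn /allP /(_ j jt); rewrite eqxx.
rewrite shift_cylinder.
(* Disjointness of the two index lists allows merging both constraints into a single family, hence a
   single cylinder. *)
pose C i := if i \in u then A' i else B' (iter n s' i).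
have -> : cylinder u A' `&` cylinder (map (iter n s) t) (fun i => B' (iter n s' i))
   = cylinder (u ++ map (iter n s) t) C.
  apply/seteqP; split => z.
    move=> [h1 h2] i; rewrite mem_cat /C; case: ifP => [iu _|_ /= it]; first exact: h1.
    exact: h2.
  move=> h; split => [i iu|_ /mapP[j jt ->]].
    by have := h i; rewrite mem_cat /C iu => /(_ isT).
  have := h (iter n s j); rewrite mem_cat /C dis //=; apply; exact: map_f.
rewrite !indep //.
- rewrite big_cat big_map /=; congr (_ * _)%E; apply: eq_big_seq => i hi; rewrite /C.
    by rewrite hi.
  by rewrite dis // iterK stat_iter.
- rewrite cat_uniq uu map_inj_uniq ?ut ?andbT /=; last exact: can_inj (iterK n).
  by apply/hasPn => _ /mapP[j jt ->]; rewrite dis.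
- by move=> i; rewrite /C; case: ifP.
Qed.

Lemma shift_ergodic A : measurable A -> shift @^-1` A = A ->
  mu A = 0%E \/ mu A = 1%E.
Proof.
apply: (mixing_ergodic measurable_shift shift_preserving erefl).
- exact: cylinders_setI.
- exact: cylinders_setT.
- exact: shift_mixing.
Qed.

End shift.

(** Invariance under [update] at [i] expresses that a function does not depend on coordinate [i],
    without mention of sub-sigma-algebras. *)
Definition update (z : Om) i x : Om := fun j => if j == i then x else z j.

Section resampling.
Variable i : I.

(** Coordinate [i] is redrawn from an independent copy. Independence splits a cylinder into its
    constraint at [i] and the others, so the result again has law [mu]. A product [f (z i) * h z],
    with [h] blind to coordinate [i], thereby becomes a product of functions of two separate
    variables, and Fubini's theorem applies. *)
Let resample (p : Om * Om) : Om := update p.1 i (p.2 i).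

Let measurable_resample : measurable_fun setT resample.
Proof.
apply: measurable_coordP => j; rewrite /resample /update; case: eqP => _.
  exact: (measurableT_comp (measurable_coord i) measurable_snd).
exact: (measurableT_comp (measurable_coord j) measurable_fst).
Qed.

Let resample_preserving A : measurable A -> (mu \x mu)%E (resample @^-1` A) = mu A.
Proof.
move=> mA.
pose nu := distribution (mu \x mu)%E
  (mfun_Sub (mem_set measurable_resample) : {mfun (Om * Om)%type >-> Om}).
apply: (@probability_cylinder_eq _ _ nu mu) => // s B us mB.
rewrite [LHS](_ : _ = (mu \x mu)%E (cylinder [seq j <- s | j != i] B `*`
                             cylinder [seq j <- s | j == i] B)); last first.
  congr ((mu \x mu)%E _); apply/seteqP; split => -[z z'] /=.
    move=> h; split => j; rewrite mem_filter => /andP[ji js]; have := h j js.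
      by rewrite /resample /update /= (negPf ji).
    by rewrite /resample /update /= ji (eqP ji).
  move=> [h1 h2] j js; rewrite /resample /update /=; case: ifPn => ji.
    by have := h2 j; rewrite mem_filter ji js (eqP ji) => /(_ isT).
  by apply: h1; rewrite mem_filter ji.
rewrite [LHS]product_measure1E; do ?exact: measurable_cylinder.
rewrite !indep ?filter_uniq // [RHS](bigID (fun j => j == i)) /= muleC.
by congr (_ * _)%E; rewrite -big_filter; apply: indep => //; exact: filter_uniq.
Qed.

Variables (f : R -> R) (h : Om -> R).
Hypothesis fi : mu.-integrable setT (EFin \o (fun z => f (z i))).
Hypothesis mf : measurable_fun setT f.
Hypothesis hi : mu.-integrable setT (EFin \o h).
Hypothesis hu : forall z x, h (update z i x) = h z.

Let g (p : Om * Om) : \bar R := (f (p.2 i) * h p.1)%:E.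

Let mg : measurable_fun setT g.
Proof.
apply/measurable_EFinP; apply: measurable_funM.
  apply: (measurableT_comp mf).
  exact: (measurableT_comp (measurable_coord i) measurable_snd).
exact: (measurableT_comp (integrable_measurable hi) measurable_fst).
Qed.

Let gi : (mu \x mu)%E.-integrable setT g.
Proof.
apply/integrable12ltyP => //.
under eq_integral => z _.
  under eq_integral => z' _ do rewrite /g /= normrM EFinM muleC.
  rewrite ge0_integralZl //; last first.
    by apply/measurable_EFinP/measurableT_comp => //; exact: integrable_measurable fi.
  over.
rewrite ge0_integralZr //.
- apply: lte_mul_pinfty.
  + exact: integral_ge0.
  + rewrite ge0_fin_numE ?integral_ge0 //.
    exact: (integrable_lty measurableT (integrable_norm hi)).
  + exact: (integrable_lty measurableT (integrable_norm fi)).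
- by apply/measurable_EFinP/measurableT_comp => //; exact: integrable_measurable hi.
- exact: integral_ge0.
Qed.

Let gE p : g p = (f (resample p i) * h (resample p))%:E.
Proof. by rewrite /g /resample hu /update eqxx. Qed.

Lemma integrable_coordM : mu.-integrable setT (EFin \o (fun z => f (z i) * h z)).
Proof.
have mF : measurable_fun setT (fun z : Om => f (z i) * h z).
  apply: measurable_funM; last exact: integrable_measurable hi.
  exact: (measurableT_comp mf (measurable_coord i)).
apply/integrableP; split; first exact/measurable_EFinP.
rewrite -(ge0_integral_preserving measurable_resample resample_preserving) //.
  have /integrableP[_] := gi; apply: le_lt_trans.
  by rewrite (eq_integral (fun p => `|g p|%E)) // => p _; rewrite gE.
by apply/measurable_EFinP; exact: measurableT_comp.
Qed.

Lemma Rintegral_coordM :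
  \int[mu]_z (f (z i) * h z) = (\int[mu]_z f (z i)) * (\int[mu]_z h z).
Proof.
rewrite -(Rintegral_preserving measurable_resample resample_preserving integrable_coordM).
rewrite {1}/Rintegral; under eq_integral do rewrite -gE.
rewrite -(integral12_prod_meas1 gi) /fubini_F.
under eq_integral => z _.
  under eq_integral => z' _ do rewrite /g /= mulrC EFinM.
  rewrite integralZl // -[X in (_ * X)%E]fineK; last exact: (integrable_fin_num _ fi).
  over.
by rewrite integralZr // -[X in (X * _)%E]fineK ?(integrable_fin_num _ hi) //= mulrC.
Qed.

End resampling.
End independent_coordinates.

(** * The joint law of the two noises, indexed by a flag ([true] for [eta], [false] for [eps]) and a
    time *)

Definition time_shift (i : bool * int) : bool * int := (i.1, i.2 + 1).
Definition time_unshift (i : bool * int) : bool * int := (i.1, i.2 - 1).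

Lemma time_shiftK : cancel time_shift time_unshift.
Proof. by move=> [b t]; rewrite /time_shift /time_unshift /= addrK. Qed.

Lemma iter_time_shift n i : iter n time_shift i = (i.1, i.2 + n%:Z).
Proof.
elim: n => [|n IH]; first by case: i => b t; rewrite addr0.
by rewrite iterS IH /time_shift /= -addrA intS [1 + _]addrC.
Qed.

Lemma time_shift_wandering i j : \forall n \near \oo, iter n time_shift j != i.
Proof.
exists (`|i.2 - j.2|%N).+1 => // n /= hn; apply/eqP => h; move: hn; rewrite -h.
by rewrite iter_time_shift /= [_ + n%:Z]addrC addrK absz_nat ltnn.
Qed.

Section joint_law.
Context d (T : measurableType d) (R : realType) (P : probability T R).
Variables eps eta : int -> {RV P >-> R}.
Hypothesis heps : strong_white_noise eps.
Hypothesis heta : strong_white_noise eta.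
Hypothesis hindep : independent_processes eps eta.

Local Notation Om := (coord_space (bool * int)%type R).

Definition noise (i : bool * int) : {RV P >-> R} :=
  if i.1 then eta i.2 else eps i.2.

Definition joint_noise (w : T) : Om := fun i => noise i w.

Lemma measurable_joint_noise : measurable_fun setT joint_noise.
Proof. by apply: measurable_coordP => i; exact: measurable_funP. Qed.

Definition noise_law : probability Om R :=
  distribution P (mfun_Sub (mem_set measurable_joint_noise) : {mfun T >-> Om}).

Lemma noise_lawE A : noise_law A = P (joint_noise @^-1` A).
Proof. by []. Qed.

(** The part of a cylinder event that constrains only one of the two noises, in the form in which
    independence within a white noise is stated. *)
Let noise_event (b : bool) (s : seq (bool * int)) (A : bool * int -> set R) :=
  \bigcap_(t in [set` [seq i.2 | i <- s & i.1 == b]]) (noise (b, t) @^-1` A (b, t)).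

Let noise_event_prob b s A : uniq s -> (forall i, measurable (A i)) ->
  P (noise_event b s A) = (\prod_(i <- s | i.1 == b) P (noise i @^-1` A i))%E.
Proof.
move=> us mA.
have u2 : uniq [seq i.2 | i <- s & i.1 == b].
  rewrite map_inj_in_uniq ?filter_uniq // => -[b1 t1] [b2 t2].
  by rewrite !mem_filter /= => /andP[/eqP -> _] /andP[/eqP -> _] ->.
have -> : P (noise_event b s A) =
    (\prod_(t <- [seq i.2 | i <- s & i.1 == b]) P (noise (b, t) @^-1` A (b, t)))%E.
  case: b u2 => u2.
    exact: (heta.1 _ (fun t => A (true, t)) u2).
  exact: (heps.1 _ (fun t => A (false, t)) u2).
rewrite big_map big_filter; apply: eq_bigr => -[b' t] /= /eqP ->; by [].
Qed.

Let sigma_event (Y : int -> {RV P >-> R}) (s : seq int) (A : int -> set R) :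
  (forall t, measurable (A t)) ->
  sigma_of_process Y (\bigcap_(t in [set` s]) (Y t @^-1` A t)).
Proof.
move=> mA; rewrite bigcap_seq.
have [S0 SD SU] : sigma_algebra setT (sigma_of_process Y).
  exact: smallest_sigma_algebra.
have SC B : sigma_of_process Y B -> sigma_of_process Y (~` B).
  by move=> /SD; rewrite setTD.
elim: s => [|t s IH]; first by rewrite big_nil -setC0; exact: SC.
rewrite big_cons -[X in sigma_of_process Y X]setCK setCI; apply: (SC).
rewrite -bigcup2E; apply: SU => -[|[|n]] //=; last exact: SC.
by apply: SC; apply: sub_gen_smallest; exists t, (A t).
Qed.

(** Independence of the two processes separates the [eps] part of the event from its [eta] part;
    independence within each noise then factors both. *)
Lemma noise_law_indep (s : seq (bool * int)) (A : bool * int -> set R) :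
  uniq s -> (forall i, measurable (A i)) ->
  noise_law (cylinder s A) =
  (\prod_(i <- s) noise_law ((fun z => z i) @^-1` A i))%E.
Proof.
move=> us mA; rewrite noise_lawE.
have -> : joint_noise @^-1` cylinder s A = noise_event false s A `&` noise_event true s A.
  apply/seteqP; split => w /=.
    move=> h; split => t /= ht.
      have /mapP[[b u]] : t \in [seq i.2 | i <- s & i.1 == false] by exact: ht.
      by rewrite mem_filter /= => /andP[/eqP -> us'] ->; exact: (h _ us').
    have /mapP[[b u]] : t \in [seq i.2 | i <- s & i.1 == true] by exact: ht.
    by rewrite mem_filter /= => /andP[/eqP -> us'] ->; exact: (h _ us').
  move=> [h1 h2] [[] t] ht; [apply: (h2 t)|apply: (h1 t)] => /=.
    by apply/mapP; exists (true, t); rewrite // mem_filter ht.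
  by apply/mapP; exists (false, t); rewrite // mem_filter ht.
have -> : P (noise_event false s A `&` noise_event true s A) =
    (P (noise_event false s A) * P (noise_event true s A))%E.
  apply: hindep.
    exact: (@sigma_event eps _ _ (fun t => mA (false, t))).
  exact: (@sigma_event eta _ _ (fun t => mA (true, t))).
rewrite !noise_event_prob // [RHS](bigID (fun i => i.1 == false)) /=.
congr (_ * _)%E; apply: eq_bigl => -[[] t] //.
Qed.

Lemma noise_law_stat i A : measurable A ->
  noise_law ((fun z => z (time_shift i)) @^-1` A) =
  noise_law ((fun z => z i) @^-1` A).
Proof.
move=> mA; rewrite !noise_lawE; case: i => -[] t.
  exact: (heta.2 (t + 1) t A mA).
exact: (heps.2 (t + 1) t A mA).
Qed.

End joint_law.

(** * Powers of a matrix of spectral radius less than 1 *)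

Section matrix_powers.
Context (R : realType) (n : nat).
Local Notation C := R[i].
Local Notation normc := Normc.normc.

Lemma normc_ge0 (z : C) : 0 <= normc z.
Proof. by case: z => a b; exact: sqrtr_ge0. Qed.

(* The factors [A - z] are peeled off one at a time: if [A^k (A - z) N] decays
   like [r^k], then [b_k = A^k N] solves [b_(k+1) = z b_k + O(r^k)]. *)
Lemma annihilated_powers_decay (A : 'M[C]_n.+1) (r : R) (s : seq C) (N : 'M[C]_n.+1) :
  0 < r -> (forall z, z \in s -> normc z < r) ->
  \prod_(z <- s) (A - z%:M) * N = 0 ->
  exists2 K : R, 0 <= K & forall k i j, normc ((A ^+ k * N) i j) <= K * r ^+ k.
Proof.
move=> r0; elim: s N => [|z s IH] N hs.
  rewrite big_nil mul1r => ->; exists 0 => // k i j.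
  by rewrite mulr0 mxE Normc.normc0 mul0r.
rewrite big_cons => hN.
have comm : GRing.comm (A - z%:M) (\prod_(z <- s) (A - z%:M)).
  apply: commr_prod => y _; apply: commrB; last exact: comm_mx_scalar.
  by apply/commr_sym/commrB => //; exact: comm_mx_scalar.
have [||K K0 hK] := IH ((A - z%:M) * N).
- by move=> y ys; apply: hs; rewrite inE ys orbT.
- by rewrite mulrA -comm.
have zr : normc z < r by apply: hs; rewrite inE eqxx.
(* The first summand covers [k = 0]. The second gives [K <= L * (r - |z|)], which closes the
   induction: [K r^k + |z| L r^k <= L r^(k+1)]. *)
pose L := \sum_i \sum_j normc (N i j) + K / (r - normc z).
have L1 i j : normc (N i j) <= L.
  rewrite /L (bigD1 i) //= (bigD1 j) //= -!addrA lerDl !addr_ge0 //.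
  - by apply: sumr_ge0 => *; exact: normc_ge0.
  - by apply: sumr_ge0 => ? _; apply: sumr_ge0 => *; exact: normc_ge0.
  - by rewrite divr_ge0 // subr_ge0 ltW.
have L2 : K <= L * (r - normc z).
  rewrite -ler_pdivrMr ?subr_gt0 // /L lerDr.
  by apply: sumr_ge0 => ? _; apply: sumr_ge0 => *; exact: normc_ge0.
have L0 : 0 <= L by exact: le_trans (normc_ge0 _) (L1 ord0 ord0).
exists L => // k i j; elim: k => [|k IHk]; first by rewrite expr0 mul1r mulr1.
have -> : A ^+ k.+1 * N = A ^+ k * ((A - z%:M) * N) + z *: (A ^+ k * N).
  have -> : z *: (A ^+ k * N) = A ^+ k * (z%:M * N).
    by rewrite (mul_scalar_mx z N : z%:M * N = z *: N) scalerAr.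
  by rewrite mulrBl mulrBr mulrA -exprSr subrK.
rewrite mxE [X in _ + X]mxE; apply: le_trans (le_normcD _ _) _.
rewrite Normc.normcM exprSr; have := hK k i j; have := exprn_ge0 k (ltW r0).
set q := r ^+ k in IHk *; move=> q0 h1.
have h2 : normc z * normc ((A ^+ k * N) i j) <= normc z * (L * q).
  by rewrite ler_wpM2l // normc_ge0.
have h3 : K * q <= L * (r - normc z) * q by rewrite ler_wpM2r.
apply: le_trans (lerD h1 h2) _; apply: le_trans (lerD h3 (lexx _)) _.
by rewrite le_eqVlt; apply/orP; left; apply/eqP; ring.
Qed.

(** Over the complex numbers the characteristic polynomial splits, and by Cayley-Hamilton the
    product of the factors [A - z] over its roots annihilates the identity. *)
Lemma spectral_radius_powers_decay (A : 'M[R]_n.+1) : spectral_radius A < 1 ->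
  exists r K : R, [/\ 0 < r, r < 1, 0 <= K &
    forall k i j, `|(A ^+ k) i j| <= K * r ^+ k].
Proof.
move=> rho1; pose Ac := map_mx (real_complex R) A.
have [s hs] := closed_field_poly_normal (char_poly Ac).
rewrite (monicP (char_poly_monic _)) scale1r in hs.
(* The midpoint lies strictly between the spectral radius and 1; the maximum with 1/2 makes [r]
   positive without any sign information on the supremum. *)
pose r := Num.max (2^-1) ((1 + spectral_radius A) / 2).
have r0 : 0 < r by rewrite lt_max invr_gt0 ltr0n.
have r1 : r < 1 by rewrite gt_max; apply/andP; split; lra.
have sr z : z \in s -> normc z < r.
  move=> zs; apply: (@le_lt_trans _ _ (spectral_radius A)); last first.
    by rewrite lt_max; apply/orP; right; lra.
  apply: ub_le_sup.
    (* [sup] dominates its set only if the set is bounded; the sum of the moduli of all roots is a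
       bound. *)
    exists (\sum_(y <- s) normc y) => _ [y /= + <-].
    rewrite eigenvalue_root_char hs root_prod_XsubC => ys.
    rewrite (big_rem y) //= lerDl; apply: sumr_ge0 => *; exact: normc_ge0.
  by exists z => //=; rewrite eigenvalue_root_char hs root_prod_XsubC.
have hprod : \prod_(z <- s) (Ac - z%:M) * 1 = 0.
  rewrite mulr1 -(Cayley_Hamilton Ac) hs rmorph_prod; apply: eq_bigr => z _.
  by rewrite rmorphB /= horner_mx_X horner_mx_C.
have [K K0 hK] := annihilated_powers_decay r0 sr hprod.
exists r, K; split => // k i j; have := hK k i j.
rewrite mulr1 -[Ac ^+ k](rmorphXn (map_mx (real_complex R))) /= mxE /=.
by rewrite expr0n /= addr0 sqrtr_sqr.
Qed.

End matrix_powers.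

(** * Means *)

Lemma normr_le_1Dsqr (R : realFieldType) (x : R) : `|x| <= 1 + x ^+ 2.
Proof.
rewrite -[x ^+ 2](real_normK (num_real x)).
by move: `|x| (normr_ge0 x) => y y0; nra.
Qed.

Lemma normrM_le_sqrD (R : realFieldType) (x y : R) : `|x * y| <= x ^+ 2 + y ^+ 2.
Proof.
rewrite normrM -[x ^+ 2](real_normK (num_real x)) -[y ^+ 2](real_normK (num_real y)).
by move: `|x| `|y| (normr_ge0 x) (normr_ge0 y) => a b a0 b0; nra.
Qed.

Section has_mean.
Context d (T : measurableType d) (R : realType).
Implicit Types (mu : {measure set T -> \bar R}) (f g : T -> R).

(** Integrability travels with the value, since the real-valued integral returns a number for
    non-integrable functions as well. *)
Definition has_mean mu f (m : R) : Prop :=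
  mu.-integrable setT (EFin \o f) /\ \int[mu]_x f x = m.

Lemma has_mean_measurable mu f m : has_mean mu f m -> measurable_fun setT f.
Proof. by move=> [/integrable_measurable]. Qed.

Lemma has_mean_ext mu f g m : f =1 g -> has_mean mu f m -> has_mean mu g m.
Proof. by move=> /funext ->. Qed.

Lemma has_mean_eq mu f m m' : m = m' -> has_mean mu f m -> has_mean mu f m'.
Proof. by move=> ->. Qed.

Lemma has_meanD mu f g a b : has_mean mu f a -> has_mean mu g b ->
  has_mean mu (fun x => f x + g x) (a + b).
Proof.
move=> [fi <-] [gi <-]; split; last by rewrite RintegralD.
rewrite (_ : _ \o _ = ((EFin \o f) \+ (EFin \o g))%E) //.
exact: integrableD.
Qed.

Lemma has_meanZ mu c f a : has_mean mu f a -> has_mean mu (fun x => c * f x) (c * a).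
Proof.
move=> [fi <-]; split; last by rewrite RintegralZl.
rewrite (_ : _ \o _ = (fun x => c%:E * (EFin \o f) x)%E) //.
exact: integrableZl.
Qed.

Lemma has_mean_sum mu (F : nat -> T -> R) (a : nat -> R) n :
  (forall k, has_mean mu (F k) (a k)) ->
  has_mean mu (fun x => \sum_(k < n) F k x) (\sum_(k < n) a k).
Proof.
move=> h; elim: n => [|n IH].
  rewrite big_ord0; split; last first.
    by rewrite /Rintegral; under eq_integral do rewrite big_ord0; rewrite integral0.
  by rewrite (_ : _ \o _ = cst 0%E) ?integrable0 //; apply/funext => x /=; rewrite big_ord0.
rewrite big_ord_recr; apply: has_mean_ext (has_meanD IH (h n)) => x.
by rewrite big_ord_recr.
Qed.

Lemma has_mean_dom mu f g m : measurable_fun setT g -> (forall x, `|g x| <= f x) ->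
  has_mean mu f m -> has_mean mu g (\int[mu]_x g x).
Proof.
move=> mg gf [fi _]; split => //.
apply: le_integrable fi => //; first exact/measurable_EFinP.
by move=> x _ /=; rewrite lee_fin; apply: le_trans (gf x) (ler_norm _).
Qed.

Lemma has_mean_ae mu f g m : measurable_fun setT g -> {ae mu, forall x, f x = g x} ->
  has_mean mu f m -> has_mean mu g m.
Proof.
move=> mg fg [fi <-].
have mf := integrable_measurable fi.
split; last first.
  rewrite /Rintegral; congr fine; apply: ae_eq_integral => //.
  - exact/measurable_EFinP.
  - exact/measurable_EFinP.
  - by apply: filterS fg => x /= ->.
apply/integrableP; split; first exact/measurable_EFinP.
have /integrableP[_] := fi; apply: le_lt_trans.
rewrite (_ : (\int[mu]_x `|(EFin \o g) x|)%E = (\int[mu]_x `|(EFin \o f) x|)%E) //.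
apply: ae_eq_integral => //.
- by apply/measurableT_comp => //; exact/measurable_EFinP.
- by apply/measurableT_comp => //; exact/measurable_EFinP.
- by apply: filterS fg => x /= ->.
Qed.

Lemma has_mean_le mu f g a b : has_mean mu f a -> has_mean mu g b ->
  (forall x, f x <= g x) -> a <= b.
Proof. by move=> [fi <-] [gi <-] fg; apply: le_Rintegral. Qed.

Lemma has_mean_ge0 mu f a : has_mean mu f a -> (forall x, 0 <= f x) -> 0 <= a.
Proof. by move=> [fi <-] f0; apply: Rintegral_ge0. Qed.

Lemma has_mean_int mu f m : has_mean mu f m -> (\int[mu]_x (f x)%:E = m%:E)%E.
Proof. by move=> [fi <-]; rewrite /Rintegral fineK // (integrable_fin_num _ fi). Qed.

Lemma has_mean_cst (P : probability T R) c : has_mean P (fun=> c) c.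
Proof.
split; first exact: (finite_measure_integrable_cst P c).
by rewrite Rintegral_cst //= probability_setT mulr1.
Qed.

End has_mean.

Lemma has_mean_preserving d1 d2 (T1 : measurableType d1) (T2 : measurableType d2)
    (R : realType) (mu1 : {measure set T1 -> \bar R}) (mu2 : {measure set T2 -> \bar R})
    (phi : T1 -> T2) (f : T2 -> R) m : measurable_fun setT phi ->
  (forall A, measurable A -> mu1 (phi @^-1` A) = mu2 A) -> measurable_fun setT f ->
  has_mean mu1 (f \o phi) m <-> has_mean mu2 f m.
Proof.
move=> mphi pphi mf.
suff fi : mu1.-integrable setT (EFin \o (f \o phi)) -> mu2.-integrable setT (EFin \o f).
  split=> -[hi <-].
    by split; [exact: fi|rewrite -(Rintegral_preserving mphi pphi (fi hi))].
  split; last exact: (Rintegral_preserving mphi pphi hi).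
  exact: (integrable_preserving mphi pphi hi).
move=> /integrableP[_ h]; apply/integrableP; split; first exact/measurable_EFinP.
rewrite -(ge0_integral_preserving mphi pphi) //.
by apply/measurableT_comp => //; exact/measurable_EFinP.
Qed.

(** * Moments of the causal series *)

Section one_step.
Context (R : realType).
Local Notation Om := (coord_space (bool * int)%type R).
Variable mu : probability Om R.
Hypothesis indep : forall (s : seq (bool * int)) (A : bool * int -> set R), uniq s ->
  (forall i, measurable (A i)) ->
  mu (cylinder s A) = (\prod_(i <- s) mu ((fun z => z i) @^-1` A i))%E.
Hypothesis stat : forall i A, measurable A ->
  mu ((fun z => z (time_shift i)) @^-1` A) = mu ((fun z => z i) @^-1` A).
Variables (theta alpha : R).

Local Notation tau := (@shift _ R time_shift).
Local Notation mean := (has_mean mu).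

Lemma measurable_time_shift : measurable_fun setT tau.
Proof. exact: measurable_shift. Qed.

Lemma time_shift_preserving A : measurable A -> mu (tau @^-1` A) = mu A.
Proof. exact: (shift_preserving indep time_shiftK stat). Qed.

Lemma mean_shift f m : measurable_fun setT f -> mean (f \o tau) m <-> mean f m.
Proof. exact: has_mean_preserving measurable_time_shift time_shift_preserving. Qed.

Lemma mean_coordM i f h a b : measurable_fun setT f ->
  mean (fun z => f (z i)) a -> mean h b -> (forall z x, h (update z i x) = h z) ->
  mean (fun z => f (z i) * h z) (a * b).
Proof.
move=> mf [fi <-] [hi <-] hu; split; first exact: integrable_coordM.
exact: Rintegral_coordM.
Qed.

Variables (mom : nat -> R).
Hypothesis hmom : forall j, (j <= 4)%N -> mean (fun z => z (true, 0) ^+ j) (mom j).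

Let mean_eta1 j : (j <= 4)%N -> mean (fun z => z (true, 1) ^+ j) (mom j).
Proof.
move=> j4; apply: (has_mean_ext _ ((mean_shift _ _).2 (hmom j4))) => //.
exact: integrable_measurable (hmom j4).1.
Qed.

Definition coef1 (z : Om) : R := theta + alpha * z (true, 0) + z (true, 1).

(** With [u] independent of eta_1, the integrand splits as [eta_1^j (theta + alpha eta_0) u +
    eta_1^(j+1) u], and each summand is a product of independent factors. The exponent [j + 1] must
    stay at most 4. *)
Lemma step_mean u A B : mean u A -> mean (fun z => z (true, 0) * u z) B ->
  (forall z x, u (update z (true, 1) x) = u z) ->
  forall j, (j <= 3)%N -> mean (fun z => z (true, 1) ^+ j * (coef1 z * u z))
    (mom j * (theta * A + alpha * B) + mom j.+1 * A).
Proof.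
move=> hA hB hu j j3.
have h1 : mean (fun z => theta * u z + alpha * (z (true, 0) * u z)) (theta * A + alpha * B).
  by apply: has_meanD; exact: has_meanZ.
have mX k : measurable_fun setT (fun x : R => x ^+ k) by exact: exprn_measurable.
have u1 z x : theta * u (update z (true, 1) x) + alpha *
    (update z (true, 1) x (true, 0) * u (update z (true, 1) x)) =
    theta * u z + alpha * (z (true, 0) * u z) by rewrite hu.
have := has_meanD (mean_coordM (mX j) (mean_eta1 (leqW j3)) h1 u1)
  (mean_coordM (mX j.+1) (mean_eta1 (j3 : (j.+1 <= 4)%N)) hA hu).
by apply: has_mean_ext => z; rewrite /coef1 exprS; ring.
Qed.

(** One of the two factors theta_1 is expanded: [step_mean] is applied to
    [(theta + alpha eta_0) u^2] with weight [eta_1^j] and to [u^2] with weight [eta_1^(j+1)]. With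
    vanishing odd moments, [j = 0, 1, 2] produce the three rows of the matrix. *)
Lemma step_mean_sq u A B C : mean (fun z => u z ^+ 2) A ->
  mean (fun z => z (true, 0) * u z ^+ 2) B ->
  mean (fun z => z (true, 0) ^+ 2 * u z ^+ 2) C ->
  (forall z x, u (update z (true, 1) x) = u z) ->
  forall j, (j <= 2)%N -> mean (fun z => z (true, 1) ^+ j * (coef1 z * u z) ^+ 2)
    (mom j * (theta ^+ 2 * A + 2 * alpha * theta * B + alpha ^+ 2 * C) +
     2 * mom j.+1 * (theta * A + alpha * B) + mom j.+2 * A).
Proof.
move=> hA hB hC hu j j2.
have hu2 z x : u (update z (true, 1) x) ^+ 2 = u z ^+ 2 by rewrite hu.
pose w z := theta * u z ^+ 2 + alpha * (z (true, 0) * u z ^+ 2).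
have hA' : mean w (theta * A + alpha * B).
  by apply: has_meanD; exact: has_meanZ.
have hB' : mean (fun z => z (true, 0) * w z) (theta * B + alpha * C).
  have := has_meanD (has_meanZ theta hB) (has_meanZ alpha hC).
  by apply: has_mean_ext => z; rewrite /w; ring.
have hw z x : w (update z (true, 1) x) = w z by rewrite /w hu.
have := has_meanD (step_mean hA' hB' hw (leqW j2)) (step_mean hA hB hu2 (j2 : (j.+1 <= 3)%N)).
move=> h; apply: (has_mean_eq _ (has_mean_ext _ h)); first by ring.
by move=> z; rewrite /w /coef1 [_ ^+ j.+1]exprS; ring.
Qed.

End one_step.

Section series_terms.
Context (R : realType).
Local Notation Om := (coord_space (bool * int)%type R).
Local Notation tau := (@shift _ R time_shift).
Variables (theta alpha : R).

Definition coef (t : int) (z : Om) : R := theta + alpha * z (true, t - 1) + z (true, t).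

Definition term (k : nat) (t : int) (z : Om) : R :=
  z (false, t - k%:Z) * \prod_(0 <= l < k) coef (t - l%:Z) z.

Definition psum (m : nat) (t : int) (z : Om) : R := \sum_(k < m) term k t z.

Lemma coef_shift t z : coef t (tau z) = coef (t + 1) z.
Proof. by rewrite /coef /shift /= /time_shift /= [t - 1 + 1]addrAC. Qed.

Lemma term_shift k t z : term k t (tau z) = term k (t + 1) z.
Proof.
rewrite /term; congr (_ * _).
  by rewrite /shift /= /time_shift /= addrAC.
by apply: eq_bigr => l _; rewrite coef_shift addrAC.
Qed.

Lemma psum_shift m t z : psum m t (tau z) = psum m (t + 1) z.
Proof. by apply: eq_bigr => k _; exact: term_shift. Qed.

Lemma psum_iter_shift m n z : psum m 0 (iter n tau z) = psum m n%:Z z.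
Proof.
elim: n z => [|n IH] z //.
by rewrite iterSr IH psum_shift intS addrC.
Qed.

Lemma term0 t z : term 0 t z = z (false, t).
Proof. by rewrite /term big_nil mulr1 subr0. Qed.

(** The newest coefficient is split off rather than the oldest: what remains is a term at time 0,
    which does not involve eta_1. *)
Lemma termS k z : term k.+1 1 z = coef1 theta alpha z * term k 0 z.
Proof.
rewrite /term big_nat_recl // mulrCA; congr (_ * _).
have e (l : nat) : 1 - l.+1%:Z = 0 - l%:Z by rewrite intS opprD addrA subrr.
by rewrite e; congr (_ * _); apply: eq_bigr => l _; rewrite e.
Qed.

Lemma psumS m z : psum m.+1 1 z = z (false, 1) + coef1 theta alpha z * psum m 0 z.
Proof.
rewrite /psum big_ord_recl term0 mulr_sumr; congr (_ + _).
by apply: eq_bigr => k _; rewrite -termS.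
Qed.

Lemma term_update k i z x : 0 < i.2 -> term k 0 (update z i x) = term k 0 z.
Proof.
move=> i0.
have h b (t : int) : t <= 0 -> update z i x (b, t) = z (b, t).
  rewrite /update => t0; case: eqP => // it; move: i0; rewrite -it /=.
  by rewrite ltNge t0.
rewrite /term h; last by rewrite sub0r oppr_le0.
by congr (_ * _); apply: eq_bigr => l _; rewrite /coef !h // sub0r -?opprD oppr_le0.
Qed.

Lemma measurable_coef t : measurable_fun setT (coef t).
Proof.
apply: measurable_funD; last exact: measurable_coord.
by apply: measurable_funD => //; apply: measurable_funM => //; exact: measurable_coord.
Qed.

Lemma measurable_term k t : measurable_fun setT (term k t).
Proof.
apply: measurable_funM; first exact: measurable_coord.
rewrite (_ : (fun z => _) = (fun z => \prod_(l <- index_iota 0 k) coef (t - l%:Z) z)) //.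
by apply: measurable_prod => l _; exact: measurable_coef.
Qed.

Lemma measurable_psum m t : measurable_fun setT (psum m t).
Proof. by apply: measurable_sum => k; exact: measurable_term. Qed.

Variable mu : probability Om R.
Hypothesis indep : forall (s : seq (bool * int)) (A : bool * int -> set R), uniq s ->
  (forall i, measurable (A i)) ->
  mu (cylinder s A) = (\prod_(i <- s) mu ((fun z => z i) @^-1` A i))%E.
Hypothesis stat : forall i A, measurable A ->
  mu ((fun z => z (time_shift i)) @^-1` A) = mu ((fun z => z i) @^-1` A).
Local Notation mean := (has_mean mu).

Variables (sigma2 tau2 tau4 : R).
Let mom j := nth 0 [:: 1; 0; tau2; 0; tau4] j.
Hypothesis heta : forall j, (j <= 4)%N -> mean (fun z => z (true, 0) ^+ j) (mom j).
Hypothesis heps1 : mean (fun z => z (false, 0)) 0.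
Hypothesis heps2 : mean (fun z => z (false, 0) ^+ 2) sigma2.

Local Notation M := (mxM theta alpha tau2 tau4).

Let q0 : 'cV[R]_3 := \col_i nth 0 [:: sigma2; 0; tau2 * sigma2] i.

(** The three means of the squared [k]-th term, weighted by 1, eta_0 and eta_0^2; [q0] holds their
    values for the zeroth term eps_0. *)
Definition second_moments k : 'cV[R]_3 := M ^+ k *m q0.

Let i0 : 'I_3 := ord0.
Let i1 : 'I_3 := lift ord0 ord0.
Let i2 : 'I_3 := lift ord0 (lift ord0 ord0).

Let mpow k : measurable_fun setT (fun x : R => x ^+ k).
Proof. exact: exprn_measurable. Qed.

(** By stationarity term [k + 1] may be evaluated at time 1 with weights [eta_1^j], where [termS]
    and [step_mean_sq] apply. *)
Lemma term_mean_sq k :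
  [/\ mean (fun z => term k 0 z ^+ 2) (second_moments k i0 0),
      mean (fun z => z (true, 0) * term k 0 z ^+ 2) (second_moments k i1 0) &
      mean (fun z => z (true, 0) ^+ 2 * term k 0 z ^+ 2) (second_moments k i2 0)].
Proof.
elim: k => [|k [hA hB hC]].
  rewrite /second_moments expr0 mul1mx !mxE /=.
  have hs (z : Om) x : z (false, 0) ^+ 2 = update z (true, 0) x (false, 0) ^+ 2 by [].
  split.
  - by apply: (has_mean_ext _ heps2) => z; rewrite term0.
  - have := mean_coordM indep (mpow 1) (heta (isT : (1 <= 4)%N)) heps2
      (fun z x => esym (hs z x)).
    move=> h; apply: (has_mean_eq _ (has_mean_ext _ h)); first by rewrite /mom /= mul0r.
    by move=> z; rewrite term0 expr1.
  - have := mean_coordM indep (mpow 2) (heta (isT : (2 <= 4)%N)) heps2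
      (fun z x => esym (hs z x)).
    by apply: has_mean_ext => z; rewrite term0.
have hu z x : term k 0 (update z (true, 1) x) = term k 0 z by exact: term_update.
have step := step_mean_sq indep stat theta alpha heta hA hB hC hu.
have qS i : second_moments k.+1 i 0 = M i i0 * second_moments k i0 0 +
    (M i i1 * second_moments k i1 0 + M i i2 * second_moments k i2 0).
  rewrite {1}/second_moments exprS -mulmxA -/(second_moments k) mxE.
  by rewrite !big_ord_recl big_ord0 addr0.
have mt := measurable_term k.+1 0.
have me : measurable_fun setT (fun z : Om => z (true, 0)) by exact: measurable_coord.
rewrite !qS; set a := second_moments k i0 0 in step *; set b := second_moments k i1 0 in step *.
set c := second_moments k i2 0 in step *; rewrite !mxE /=; split; apply/(mean_shift indep stat _ _).1.
- exact: measurable_funX.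
- apply: (has_mean_eq _ (has_mean_ext _ (step 0%N isT))).
    by rewrite /mom /=; ring.
  by move=> z /=; rewrite expr0 mul1r term_shift termS.
- by apply: measurable_funM => //; exact: measurable_funX.
- apply: (has_mean_eq _ (has_mean_ext _ (step 1%N isT))).
    by rewrite /mom /=; ring.
  by move=> z /=; rewrite expr1 term_shift termS.
- by apply: measurable_funM => //; exact: measurable_funX.
- apply: (has_mean_eq _ (has_mean_ext _ (step 2%N isT))).
    by rewrite /mom /=; ring.
  by move=> z /=; rewrite term_shift termS.
Qed.

(** [step_mean] is linear in the two means, and both vanish for [k = 0] because eps_0 is
    centered. *)
Lemma term_mean k : mean (fun z => term k 0 z) 0 /\
  mean (fun z => z (true, 0) * term k 0 z) 0.
Proof.
elim: k => [|k [hA hB]].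
  split; first by apply: (has_mean_ext _ heps1) => z; rewrite term0.
  have hs (z : Om) x : update z (true, 0) x (false, 0) = z (false, 0) by [].
  have := mean_coordM indep (mpow 1) (heta (isT : (1 <= 4)%N)) heps1 hs.
  move=> h; apply: (has_mean_eq _ (has_mean_ext _ h)); first by rewrite mulr0.
  by move=> z; rewrite term0 expr1.
have hu z x : term k 0 (update z (true, 1) x) = term k 0 z by exact: term_update.
have step := step_mean indep stat theta alpha heta hA hB hu.
have mt := measurable_term k.+1 0.
split; apply/(mean_shift indep stat _ _).1.
- by [].
- apply: (has_mean_eq _ (has_mean_ext _ (step 0%N isT))); first by ring.
  by move=> z /=; rewrite expr0 mul1r term_shift termS.
- by apply: measurable_funM => //; exact: measurable_coord.
- apply: (has_mean_eq _ (has_mean_ext _ (step 1%N isT))); first by ring.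
  by move=> z /=; rewrite expr1 term_shift termS.
Qed.

End series_terms.

(** * Almost sure limits of functions and their means *)

Lemma cvg_EFin_seq (R : realType) (u : nat -> R) (l : R) :
  u n @[n --> \oo] --> l -> (u n)%:E @[n --> \oo] --> l%:E.
Proof. by move=> ul; apply: cvg_EFin => //; exact: nearW. Qed.

Section series_of_functions.
Context d (T : measurableType d) (R : realType) (mu : {measure set T -> \bar R}).
Variable x : nat -> T -> R.
Hypothesis mx : forall k, measurable_fun setT (x k).

(** A total substitute for the limit: the upper limit is measurable in a parameter whether or not
    the sequence converges, and equals the limit where there is one. *)
Definition seq_limit (u : nat -> R) : R := fine (limn_esup (fun n => (u n)%:E)).

Lemma seq_limitE (u : nat -> R) (l : R) : u n @[n --> \oo] --> l -> seq_limit u = l.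
Proof.
move=> ul; rewrite /seq_limit; have ule : (u n)%:E @[n --> \oo] --> l%:E.
  exact: (cvg_EFin_seq ul).
by rewrite (cvg_limn_einf_sup ule).2.
Qed.

Lemma measurable_seq_limit (u : nat -> T -> R) :
  (forall n, measurable_fun setT (u n)) ->
  measurable_fun setT (fun t => seq_limit (u ^~ t)).
Proof.
move=> mu_; have me n : measurable_fun setT (fun t => (u n t)%:E).
  exact/measurable_EFinP.
exact: (measurableT_comp (fine_measurable measurableT) (measurable_fun_limn_esup me)).
Qed.

(** The dominating function is the sum of all [|x k|]. Monotone convergence bounds its integral by
    [B], so it is finite almost everywhere; it is extended-real valued because it may be infinite on
    a null set. *)
Lemma abs_summable_ae_cvg (b : nat -> R) (B : R) :
  (forall k, has_mean mu (fun t => `|x k t|) (b k)) ->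
  (forall n, \sum_(k < n) b k <= B) ->
  exists g : T -> \bar R, [/\ mu.-integrable setT g,
    forall n t, (`|\sum_(k < n) x k t|%:E <= g t)%E &
    {ae mu, forall t, cvgn (fun n => \sum_(k < n) x k t)}].
Proof.
move=> hb hB; pose g t := (\sum_(0 <= k <oo) `|x k t|%:E)%E.
have g0 t : (0 <= g t)%E by apply: nneseries_ge0 => *; rewrite lee_fin.
have mxk k : measurable_fun setT (fun t => `|x k t|%:E).
  by apply/measurable_EFinP; exact: measurableT_comp.
have gi : mu.-integrable setT g.
  apply/integrableP; split.
    rewrite (_ : g = fun t => (\sum_(0 <= k <oo | k \in xpredT) `|x k t|%:E)%E) //.
    by apply: ge0_emeasurable_sum => *; rewrite ?lee_fin.
  under eq_integral do rewrite gee0_abs //.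
  rewrite integral_nneseries //.
  apply: (@le_lt_trans _ _ B%:E); last exact: ltry.
  apply: lime_le.
    by apply: is_cvg_nneseries => *; apply: integral_ge0 => *; rewrite lee_fin.
  apply: nearW => n; rewrite big_mkord.
  under eq_bigr => k _ do rewrite (has_mean_int (hb k)).
  by rewrite sumEFin lee_fin.
have gn n t : ((\sum_(k < n) `|x k t|)%:E <= g t)%E.
  rewrite -sumEFin -(big_mkord xpredT (fun k => `|x k t|%:E)).
  by apply: nneseries_lim_ge => *; rewrite lee_fin.
exists g; split => //.
  by move=> n t; apply: le_trans (gn n t); rewrite lee_fin ler_norm_sum.
have := integrable_ae measurableT gi; apply: filterS => t /(_ I) gt.
have -> : (fun n => \sum_(k < n) x k t) = series (x ^~ t).
  by apply/funext => n; rewrite seriesEord.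
apply: normed_cvg; apply: nondecreasing_is_cvgn.
  by apply: nondecreasing_series => n _ _; exact: normr_ge0.
exists (fine (g t)) => _ [n _ <-] /=.
by rewrite -lee_fin fineK // seriesEord; exact: gn.
Qed.

Lemma cvg_mean_dominated (u : nat -> T -> R) (f : T -> R) (g : T -> \bar R) m :
  (forall n, has_mean mu (u n) m) -> measurable_fun setT f ->
  {ae mu, forall t, u n t @[n --> \oo] --> f t} -> mu.-integrable setT g ->
  (forall n t, (`|u n t|%:E <= g t)%E) -> has_mean mu f m.
Proof.
move=> hu mf uf gi ug.
have [] := @dominated_convergence _ _ _ mu setT measurableT
   (fun n t => (u n t)%:E) (EFin \o f) g.
- by move=> n; apply/measurable_EFinP; exact: has_mean_measurable (hu n).
- exact/measurable_EFinP.
- by apply: filterS uf => t ut _; exact: (cvg_EFin_seq ut).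
- by [].
- by apply: aeW => t n _; exact: ug.
move=> fi _; rewrite (_ : [sequence _]_n = fun=> m%:E); last first.
  by apply/funext => n; exact: has_mean_int (hu n).
move=> /(cvg_unique _ (cvg_cst _)) fm; split => //.
by rewrite /Rintegral -fm.
Qed.

(** Fatou's lemma gives integrability of the limit from a uniform bound on the means, and leaves the
    value of the mean unidentified. *)
Lemma fatou_mean (u : nat -> T -> R) (f : T -> R) (B : R) :
  (forall n t, 0 <= u n t) -> (forall n, exists2 m, has_mean mu (u n) m & m <= B) ->
  measurable_fun setT f -> {ae mu, forall t, u n t @[n --> \oo] --> f t} ->
  exists m, has_mean mu f m.
Proof.
move=> u0 hu mf uf; exists (\int[mu]_t f t); split => //.
have mu_ n : measurable_fun setT (fun t => (u n t)%:E).
  by have [m hm _] := hu n; apply/measurable_EFinP; exact: has_mean_measurable hm.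
apply/integrableP; split; first exact/measurable_EFinP.
rewrite (_ : (\int[mu]_t _)%E = (\int[mu]_t limn_einf (fun n => (u n t)%:E))%E); last first.
  apply: ae_eq_integral => //.
  - by apply/measurableT_comp => //; exact/measurable_EFinP.
  (* Measurability of the lower limit is obtained from that of an upper limit by a change of
     sign. *)
  - have -> : (fun t => limn_einf (fun n => (u n t)%:E)) =
        (fun t => - limn_esup (fun n => (- u n t)%:E))%E.
      by apply/funext => t; rewrite -limn_einfN; congr limn_einf;
         apply/funext => n /=; rewrite opprK.
    apply: measurableT_comp => //.
    apply: (@measurable_fun_limn_esup _ _ _ _ (fun n t => (- u n t)%:E)) => n.
    apply/measurable_EFinP; apply: measurableT_comp => //.
    by apply/measurable_EFinP; exact: mu_.
  - apply: filterS uf => t ut _ /=.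
    have ft0 : 0 <= f t.
      rewrite -(cvg_lim (@Rhausdorff R) ut); apply: limr_ge; first exact: cvgP ut.
      exact: nearW.
    have ute : (u n t)%:E @[n --> \oo] --> (f t)%:E.
      exact: (cvg_EFin_seq ut).
    by rewrite (cvg_limn_einf_sup ute).1 ger0_norm.
apply: (@le_lt_trans _ _ B%:E); last exact: ltry.
apply: le_trans (fatou mu measurableT mu_ (fun n t _ => u0 n t)) _.
rewrite limn_einf_lim; apply: lime_le.
  exact: is_cvg_einfs.
apply: nearW => n; apply: (@le_trans _ _ (\int[mu]_t (u n t)%:E)%E).
  by apply: ereal_inf_lbound; exists n => /=.
by have [m hm mB] := hu n; rewrite (has_mean_int hm) lee_fin.
Qed.

End series_of_functions.

(* Cauchy-Schwarz with the summable weights [s ^+ k]. *)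
Lemma weighted_sum_sq (R : realFieldType) (s : R) (x : nat -> R) m : 0 < s < 1 ->
  (\sum_(k < m) x k) ^+ 2 <= (1 - s)^-1 * \sum_(k < m) (s ^+ k)^-1 * x k ^+ 2.
Proof.
move=> /andP[s0 s1]; elim: m x => [|m IH] x.
  by rewrite !big_ord0 mulr0 expr0n.
rewrite !big_ord_recl /= expr0 invr1 mul1r mulrDr.
have := IH (fun k => x k.+1).
set X := \sum_(_ < _) _; set D := (1 - s)^-1 => hX.
have -> : \sum_(i < m) (s ^+ bump 0 i)^-1 * x (bump 0 i) ^+ 2 =
   s^-1 * \sum_(k < m) (s ^+ k)^-1 * x k.+1 ^+ 2.
  by rewrite mulr_sumr; apply: eq_bigr => i _; rewrite /bump /= add1n exprS invfM mulrA.
rewrite [D * (s^-1 * _)]mulrCA; apply: (@le_trans _ _ (D * x 0%N ^+ 2 + s^-1 * X ^+ 2)); last first.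
  by rewrite lerD2l ler_wpM2l // invr_ge0 ltW.
have d0 : 0 < 1 - s by rewrite subr_gt0.
(* The convexity inequality [(x + X)^2 <= x^2 / (1 - s) + X^2 / s], with the difference written as a
   square. *)
rewrite -subr_ge0 (_ : _ - _ = ((x 0%N * s - X * (1 - s)) ^+ 2) / (s * (1 - s))).
  by rewrite divr_ge0 ?sqr_ge0 // mulr_ge0 // ltW.
by rewrite /D; field; rewrite (gt_eqF s0) (gt_eqF d0).
Qed.

(** * The stationary solution as a functional of the trajectory, and its second moments *)

Section stationary_solution.
Context (R : realType).
Local Notation Om := (coord_space (bool * int)%type R).
Local Notation tau := (@shift _ R time_shift).
Variable mu : probability Om R.
Hypothesis indep : forall (s : seq (bool * int)) (A : bool * int -> set R), uniq s ->
  (forall i, measurable (A i)) ->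
  mu (cylinder s A) = (\prod_(i <- s) mu ((fun z => z i) @^-1` A i))%E.
Hypothesis stat : forall i A, measurable A ->
  mu ((fun z => z (time_shift i)) @^-1` A) = mu ((fun z => z i) @^-1` A).
Local Notation mean := (has_mean mu).
Variables (theta alpha sigma2 tau2 tau4 : R).
Let mom j := nth 0 [:: 1; 0; tau2; 0; tau4] j.
Hypothesis heta : forall j, (j <= 4)%N -> mean (fun z => z (true, 0) ^+ j) (mom j).
Hypothesis heps1 : mean (fun z => z (false, 0)) 0.
Hypothesis heps2 : mean (fun z => z (false, 0) ^+ 2) sigma2.
Hypothesis hrho : spectral_radius (mxM theta alpha tau2 tau4) < 1.

Local Notation term := (term theta alpha).
Local Notation psum := (psum theta alpha).
Local Notation coef1 := (@coef1 R theta alpha).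

(** The value X_0 as a function of the noise trajectory, defined everywhere; X_n is its value at the
    trajectory shifted [n] times. *)
Definition causal_limit (z : Om) : R := seq_limit (fun m => psum m 0 z).

Local Notation F := causal_limit.

Lemma measurable_causal_limit : measurable_fun setT F.
Proof. by apply: measurable_seq_limit => m; exact: measurable_psum. Qed.

Lemma causal_limit_update i z x : 0 < i.2 -> F (update z i x) = F z.
Proof.
move=> i0; rewrite /F; congr seq_limit; apply/funext => m.
by apply: eq_bigr => k _; exact: term_update.
Qed.

Lemma term_second_moments_decay : exists s K : R, [/\ 0 < s < 1, 0 <= K &
  forall k, exists a c, [/\ mean (fun z => term k 0 z ^+ 2) a, a <= K * (s ^+ k) ^+ 2,
    mean (fun z => z (true, 0) ^+ 2 * term k 0 z ^+ 2) c & c <= K * (s ^+ k) ^+ 2]].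
Proof.
have [r [K [r0 r1 K0 hK]]] := spectral_radius_powers_decay hrho.
pose q0 : 'cV[R]_3 := \col_i nth 0 [:: sigma2; 0; tau2 * sigma2] i.
pose L := K * \sum_(j < 3) `|q0 j 0|.
(* The square root splits the decay [r^k] into two equal factors [s^k], to be spent separately. *)
exists (Num.sqrt r), L; split.
- by rewrite sqrtr_gt0 r0 -[X in _ < X]sqrtr1 ltr_sqrt.
- by rewrite mulr_ge0 // sumr_ge0.
move=> k; have [ha _ hc] := term_mean_sq theta alpha indep stat heta heps2 k.
have rk : (Num.sqrt r ^+ k) ^+ 2 = r ^+ k by rewrite -exprM mulnC exprM sqr_sqrtr // ltW.
have bound i : second_moments theta alpha sigma2 tau2 tau4 k i 0 <= L * r ^+ k.
  rewrite /second_moments mxE; apply: le_trans (ler_norm _) _.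
  apply: le_trans (ler_norm_sum _ _ _) _.
  rewrite /L mulrAC mulr_sumr; apply: ler_sum => j _.
  by rewrite normrM; apply: ler_wpM2r.
by do 2!eexists; split; [exact: ha|rewrite rk|exact: hc|rewrite rk].
Qed.

Let sum_geo (s c : R) n : 0 < s < 1 -> 0 <= c -> \sum_(k < n) c * s ^+ k <= c / (1 - s).
Proof.
move=> /andP[s0 s1] c0.
have := @geometric_le_lim R n c s c0 s0.
by rewrite ger0_norm ?(ltW s0) // seriesEord => /(_ s1).
Qed.

Let mterm k : measurable_fun setT (term k 0) := measurable_term theta alpha k 0.

(** The means of [|a_k|] decay like [s^k], so the series converges absolutely almost surely under an
    integrable bound, and the zero mean of the partial sums passes to the limit. *)
Lemma causal_limit_cvg :
  {ae mu, forall z, psum m 0 z @[m --> \oo] --> F z} /\ mean F 0.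
Proof.
have [s [K [s01 K0 hK]]] := term_second_moments_decay.
have [s0 s1] := andP s01.
have hb k : exists b, mean (fun z => `|term k 0 z|) b /\ b <= (1 + K) / 2 * s ^+ k.
  have [a [_ [ha aK _ _]]] := hK k.
  have sk : 0 < s ^+ k by rewrite exprn_gt0.
  (* The arithmetic-geometric inequality balanced at [s^k]: with second moment at most [K s^(2k)],
     both summands have mean of order [s^k]. *)
  have le z : `|term k 0 z| <= s ^+ k / 2 + (s ^+ k)^-1 / 2 * term k 0 z ^+ 2.
    rewrite -[term k 0 z ^+ 2]ger0_norm ?sqr_ge0 // normrX.
    move: `|_| (s ^+ k) sk => y q q0.
    rewrite -subr_ge0 (_ : _ - _ = (q - y) ^+ 2 / (q * 2)).
      by rewrite divr_ge0 ?sqr_ge0 // mulr_ge0 // ltW.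
    by field; rewrite gt_eqF.
  have hd := has_meanD (has_mean_cst mu (s ^+ k / 2)) (has_meanZ ((s ^+ k)^-1 / 2) ha).
  have mt : measurable_fun setT (fun z : Om => `|term k 0 z|) by exact: measurableT_comp.
  have le' z : `| `|term k 0 z| | <= s ^+ k / 2 + (s ^+ k)^-1 / 2 * term k 0 z ^+ 2.
    by rewrite normr_id.
  have hm := has_mean_dom mt le' hd.
  exists (\int[mu]_z `|term k 0 z|); split => //.
  apply: le_trans (has_mean_le hm hd le) _.
  have : (s ^+ k)^-1 / 2 * a <= (s ^+ k)^-1 / 2 * (K * (s ^+ k) ^+ 2).
    by rewrite ler_wpM2l // divr_ge0 // invr_ge0 ltW.
  have -> : (s ^+ k)^-1 / 2 * (K * (s ^+ k) ^+ 2) = K / 2 * s ^+ k.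
    by field; rewrite gt_eqF.
  lra.
have [b hb'] := choice hb.
have K1 : 0 <= (1 + K) / 2 by rewrite divr_ge0 // addr_ge0.
have [|g [gi gd gc]] := abs_summable_ae_cvg mterm (fun k => (hb' k).1)
    (B := (1 + K) / 2 / (1 - s)).
  by move=> n; apply: le_trans _ (sum_geo n s01 K1); apply: ler_sum => k _; exact: (hb' k).2.
have cF : {ae mu, forall z, psum m 0 z @[m --> \oo] --> F z}.
  apply: filterS gc => z /cvg_ex[l hl].
  by rewrite /F (seq_limitE hl).
split => //.
apply: (cvg_mean_dominated (u := fun m => psum m 0) (g := g) _ _ cF gi) => //.
- move=> m; have := has_mean_sum m (fun k => (term_mean theta alpha indep stat heta heps1 k).1).
  by rewrite big1.
- exact: measurable_causal_limit.
Qed.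

(** Cauchy-Schwarz bounds the square of a partial sum by the squared terms with weights [s^-k].
    These use up one factor [s^k] of the decay, and the other sums to at most [K / (1 - s)]
    uniformly in [m], so Fatou's lemma applies. *)
Let weighted_limit_mean (w : Om -> R) (K s : R) (a : nat -> R) :
  measurable_fun setT w -> (forall z, 0 <= w z) -> 0 < s < 1 -> 0 <= K ->
  (forall k, mean (fun z => w z * term k 0 z ^+ 2) (a k)) ->
  (forall k, a k <= K * (s ^+ k) ^+ 2) ->
  exists m, mean (fun z => w z * F z ^+ 2) m.
Proof.
move=> mw w0 s01 K0 ha aK; have [s0 s1] := andP s01.
have d0 : 0 <= (1 - s)^-1 by rewrite invr_ge0 subr_ge0 ltW.
apply: (fatou_mean (u := fun m z => w z * psum m 0 z ^+ 2)
   (B := (1 - s)^-1 * (K / (1 - s)))).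
- by move=> m z; rewrite mulr_ge0 // sqr_ge0.
- move=> m.
  have hd := has_meanZ (1 - s)^-1 (has_mean_sum m (fun k => has_meanZ (s ^+ k)^-1 (ha k))).
  have le z : w z * psum m 0 z ^+ 2 <=
      (1 - s)^-1 * \sum_(k < m) (s ^+ k)^-1 * (w z * term k 0 z ^+ 2).
    have -> : \sum_(k < m) (s ^+ k)^-1 * (w z * term k 0 z ^+ 2) =
        w z * \sum_(k < m) (s ^+ k)^-1 * term k 0 z ^+ 2.
      by rewrite mulr_sumr; apply: eq_bigr => k _; exact: mulrCA.
    rewrite [X in _ <= X]mulrCA. apply: ler_wpM2l => //.
    exact: (weighted_sum_sq (fun k => term k 0 z) m s01).
  have mp : measurable_fun setT (fun z => w z * psum m 0 z ^+ 2).
    by apply: measurable_funM => //; apply: measurable_funX; exact: measurable_psum.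
  have le' z : `|w z * psum m 0 z ^+ 2| <=
      (1 - s)^-1 * \sum_(k < m) (s ^+ k)^-1 * (w z * term k 0 z ^+ 2).
    by rewrite ger0_norm // mulr_ge0 // sqr_ge0.
  have hm := has_mean_dom mp le' hd.
  eexists; first exact: hm.
  apply: le_trans (has_mean_le hm hd le) _; apply: ler_wpM2l => //.
  apply: le_trans _ (sum_geo m s01 K0); apply: ler_sum => k _.
  have sk : 0 < s ^+ k by rewrite exprn_gt0.
  by rewrite mulrC ler_pdivrMr // -mulrA -expr2.
- apply: measurable_funM => //; apply: measurable_funX.
  exact: measurable_causal_limit.
- apply: filterS causal_limit_cvg.1 => z hz.
  by apply: cvgM; [exact: cvg_cst|rewrite expr2; exact: cvgM].
Qed.

Lemma causal_limit_second_moments : exists A B C,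
  [/\ mean (fun z => F z ^+ 2) A, mean (fun z => z (true, 0) * F z ^+ 2) B &
      mean (fun z => z (true, 0) ^+ 2 * F z ^+ 2) C].
Proof.
have [s [K [s01 K0 hK]]] := term_second_moments_decay.
have [a ha] := choice hK; have [c hc] := choice ha.
have me : measurable_fun setT (fun z : Om => z (true, 0)) by exact: measurable_coord.
have mF := measurable_causal_limit.
have [A hA] : exists m, mean (fun z => 1 * F z ^+ 2) m.
  apply: (weighted_limit_mean (w := fun=> 1) _ _ s01 K0 (a := a)) => // k.
    by have [h _ _ _] := hc k; apply: (has_mean_ext _ h) => z; rewrite mul1r.
  by have [_ h _ _] := hc k.
have [C hC] : exists m, mean (fun z => z (true, 0) ^+ 2 * F z ^+ 2) m.
  apply: (weighted_limit_mean (w := fun z => z (true, 0) ^+ 2) _ _ s01 K0 (a := c)) => //.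
  - exact: measurable_funX.
  - by move=> z; exact: sqr_ge0.
  - by move=> k; have [_ _ h _] := hc k.
  - by move=> k; have [_ _ _ h] := hc k.
(* The middle weight has no sign, so this mean exists by domination: [|eta_0| <= 1 + eta_0^2]. *)
exists A, (\int[mu]_z (z (true, 0) * F z ^+ 2)), C; split => //.
  by apply: (has_mean_ext _ hA) => z; rewrite mul1r.
apply: (has_mean_dom _ _ (has_meanD hA hC)).
  by apply: measurable_funM => //; exact: measurable_funX.
move=> z; rewrite mul1r normrM [`|F z ^+ 2|]ger0_norm ?sqr_ge0 //.
rewrite -{2}[F z ^+ 2]mul1r -mulrDl; apply: ler_wpM2r; first exact: sqr_ge0.
exact: normr_le_1Dsqr.
Qed.

(** The autoregressive equation for the functional: partial sums satisfy it exactly by [psumS], one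
    length apart, and it survives in the limit. *)
Lemma causal_limit_shift :
  {ae mu, forall z, coef1 z * F z + z (false, 1) = F (tau z)}.
Proof.
apply: filterS causal_limit_cvg.1 => z hz; apply/esym/seq_limitE.
rewrite -(cvg_shiftS (fun m => psum m 0 (tau z))) /=.
under eq_fun do rewrite psum_shift psumS addrC.
by apply: cvgD; [apply: cvgM => //; exact: cvg_cst|exact: cvg_cst].
Qed.

Hypothesis sigma2_gt0 : 0 < sigma2.
Hypothesis hne : 2 * alpha * tau2 != 1.

Lemma causal_limit_autocovariance : exists A, [/\ 0 < A, mean (fun z => F z ^+ 2) A &
  mean (fun z => F z * F (tau z)) (theta / (1 - 2 * alpha * tau2) * A)].
Proof.
have [A [B [C [hA hB hC]]]] := causal_limit_second_moments.
have mF := measurable_causal_limit; have hF := causal_limit_cvg.2.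
have mtau := @measurable_time_shift R.
have mFt : measurable_fun setT (fun z => F (tau z)) := measurableT_comp mF mtau.
have m1 b : measurable_fun setT (fun z : Om => z (b, 1)) by exact: measurable_coord.
have hu z x : F (update z (true, 1) x) = F z by exact: causal_limit_update.
(* The part theta_1 X_0 of X_1, which does not involve eps_1. *)
pose U z := coef1 z * F z.
have mU : measurable_fun setT U.
  apply: measurable_funM => //; apply: measurable_funD => //.
  by apply: measurable_funD => //; apply: measurable_funM => //; exact: measurable_coord.
have Uu z x : U (update z (false, 1) x) = U z.
  by rewrite /U causal_limit_update.
have heta1 j : (j <= 4)%N -> mean (fun z => z (true, 1) ^+ j) (mom j).
  move=> j4; apply: (has_mean_ext _ ((mean_shift indep stat _ _).2 (heta j4))) => //.
  exact: integrable_measurable (heta j4).1.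
have he1 : mean (fun z => z (false, 1)) 0.
  apply: (has_mean_ext _ ((mean_shift indep stat _ _).2 heps1)) => //.
  exact: integrable_measurable heps1.1.
have he2 : mean (fun z => z (false, 1) ^+ 2) sigma2.
  apply: (has_mean_ext _ ((mean_shift indep stat _ _).2 heps2)) => //.
  exact: integrable_measurable heps2.1.
have step := step_mean_sq indep stat theta alpha heta hA hB hC hu.
have hU0 : mean (fun z => U z ^+ 2) (theta ^+ 2 * A + 2 * alpha * theta * B +
    alpha ^+ 2 * C + tau2 * A).
  apply: (has_mean_eq _ (has_mean_ext _ (step 0%N isT))); first by rewrite /mom /=; ring.
  by move=> z; rewrite expr0 mul1r.
have hU1 : mean (fun z => z (true, 1) * U z ^+ 2) (2 * tau2 * (theta * A + alpha * B)).
  apply: (has_mean_eq _ (has_mean_ext _ (step 1%N isT))); first by rewrite /mom /=; ring.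
  by move=> z; rewrite expr1.
have id_meas : measurable_fun setT (fun x : R => x) by [].
have hU : mean U (\int[mu]_z U z).
  apply: (has_mean_dom mU _ (has_meanD (has_mean_cst mu 1) hU0)) => z.
  exact: normr_le_1Dsqr.
have hnU : mean (fun z => z (true, 1) * U z) (\int[mu]_z (z (true, 1) * U z)).
  apply: (has_mean_dom _ _ (has_meanD (heta1 2%N isT) hU0)); first exact: measurable_funM.
  by move=> z; exact: normrM_le_sqrD.
have heU : mean (fun z => z (false, 1) * U z) 0.
  by have := mean_coordM indep id_meas he1 hU Uu; rewrite mul0r.
have henU : mean (fun z => z (false, 1) * (z (true, 1) * U z)) 0.
  have u z x : update z (false, 1) x (true, 1) * U (update z (false, 1) x) =
     z (true, 1) * U z by rewrite Uu.
  by have := mean_coordM indep id_meas he1 hnU u; rewrite mul0r.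
have hne2 : mean (fun z => z (true, 1) * z (false, 1) ^+ 2) 0.
  have u (z : Om) x : z (false, 1) ^+ 2 = update z (true, 1) x (false, 1) ^+ 2 by [].
  have h1 : mean (fun z => z (true, 1)) 0.
    by apply: (has_mean_ext _ (heta1 1%N isT)) => z; rewrite expr1.
  by have := mean_coordM indep id_meas h1 he2 (fun z x => esym (u z x)); rewrite mul0r.
have heF : mean (fun z => z (false, 1) * F z) 0.
  have u z x : F (update z (false, 1) x) = F z by exact: causal_limit_update.
  by have := mean_coordM indep id_meas he1 hF u; rewrite mul0r.
have hB1 : mean (fun z => z (true, 1) * F (tau z) ^+ 2) B.
  have mh : measurable_fun setT (fun z : Om => z (true, 0) * F z ^+ 2).
    exact: integrable_measurable hB.1.
  exact: (has_mean_ext _ ((mean_shift indep stat _ mh).2 hB)).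
have hA1 : mean (fun z => F (tau z) ^+ 2) A.
  have mh : measurable_fun setT (fun z : Om => F z ^+ 2).
    exact: integrable_measurable hA.1.
  exact: (has_mean_ext _ ((mean_shift indep stat _ mh).2 hA)).
have ae := causal_limit_shift.
(* The mean of [eta_1 X_1^2] is [B] by stationarity, and is also computed from [X_1 = U + eps_1]:
   only [eta_1 U^2] contributes, the other two summands having mean zero. *)
have eB : B = 2 * tau2 * (theta * A + alpha * B).
  have h : mean (fun z => z (true, 1) * F (tau z) ^+ 2) (2 * tau2 * (theta * A + alpha * B)).
    have hV := has_meanD (has_meanD hU1 (has_meanZ 2 henU)) hne2.
    apply: (has_mean_ae _ _ (has_mean_eq _ hV)).
    - by apply: measurable_funM => //; exact: measurable_funX.
    - by apply: filterS ae => z <-; rewrite /U; ring.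
    - by ring.
  exact: (etrans (esym hB1.2) h.2).
have eA : A = theta ^+ 2 * A + 2 * alpha * theta * B + alpha ^+ 2 * C + tau2 * A + sigma2.
  have h : mean (fun z => F (tau z) ^+ 2)
     (theta ^+ 2 * A + 2 * alpha * theta * B + alpha ^+ 2 * C + tau2 * A + sigma2).
    have hV := has_meanD (has_meanD hU0 (has_meanZ 2 heU)) he2.
    apply: (has_mean_ae _ _ (has_mean_eq _ hV)).
    - exact: measurable_funX.
    - by apply: filterS ae => z <-; rewrite /U; ring.
    - by ring.
  exact: (etrans (esym hA1.2) h.2).
exists A; split => //.
  (* [A] is the mean of [U^2] plus [sigma2]. *)
  rewrite eA; apply: ltr_wpDl => //.
  by apply: has_mean_ge0 hU0 _ => z; exact: sqr_ge0.
have hu2 z x : F (update z (true, 1) x) ^+ 2 = F z ^+ 2 by rewrite hu.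
have h0 := step_mean indep stat theta alpha heta hA hB hu2 (isT : (0 <= 3)%N).
apply: (has_mean_ae _ _ (has_mean_eq _ (has_meanD h0 heF))).
- exact: measurable_funM.
- by apply: filterS ae => z <-; rewrite expr0; ring.
- rewrite /mom /= addr0 mul0r addr0 mul1r.
  have ne : 1 - 2 * alpha * tau2 != 0 by rewrite subr_eq0 eq_sym.
  (* Multiplied by [1 - 2 alpha tau2], the lag-one mean [theta A + alpha B] loses its [B] part by
     [eB]. *)
  apply: (mulfI ne); rewrite mulrA [_ * (theta / _)]mulrC divfK //.
  transitivity (theta * A + alpha * (B - 2 * tau2 * (theta * A + alpha * B))).
    by ring.
  by rewrite -eB subrr mulr0 addr0.
Qed.

End stationary_solution.

(** * Return to the original probability space and limit of the residual variance *)

Lemma normrX_le_1Dexp4 (R : realFieldType) (x : R) j : (j <= 4)%N ->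
  `|x ^+ j| <= 1 + x ^+ 4.
Proof.
move=> j4; rewrite -[x ^+ 4](ger0_norm (exprn_even_ge0 _ _)) // !normrX.
move: `|x| (normr_ge0 x) => y y0; case: (lerP y 1) => y1.
  by apply: (@le_trans _ _ 1); [exact: exprn_ile1|rewrite lerDl exprn_ge0].
by apply: (@le_trans _ _ (y ^+ 4)); [rewrite ler_weXn2l // ltW|rewrite lerDr].
Qed.

Section transfer.
Context d (T : measurableType d) (R : realType) (P : probability T R).

(** An even power is nonnegative, so finiteness of its expectation is integrability. *)
Lemma moment_has_mean (Y : {RV P >-> R}) a : ~~ odd a -> (moment Y a < +oo)%E ->
  has_mean P (fun w => Y w ^+ a) (fine (moment Y a)).
Proof.
rewrite /moment unlock => ea h; split => //.
apply/integrableP; split.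
  by apply/measurable_EFinP; apply: measurable_funX; exact: measurable_funP.
under eq_integral => w _ do rewrite /= ger0_norm ?exprn_even_ge0 //.
exact: h.
Qed.

Lemma odd_moment_has_mean (Y : {RV P >-> R}) k m : odd_moments_vanish Y ->
  has_mean P (fun w => Y w ^+ (2 * k + 1)) m -> has_mean P (fun w => Y w ^+ (2 * k + 1)) 0.
Proof.
move=> hY [fi _]; split => //; have := hY k fi; rewrite /moment unlock /Rintegral.
by move=> /(congr1 fine).
Qed.

Lemma autocovariance_centered (Y : T -> R) A : has_mean P Y 0 ->
  has_mean P (fun w => Y w ^+ 2) A -> fine (covariance P Y Y) = A.
Proof.
move=> h0 hA.
have l1 : Y \in Lfun P 1 by apply/Lfun1_integrable; exact: h0.1.
have e : (Y * Y)%R = (fun w => Y w ^+ 2) by apply/funext => w; rewrite expr2.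
rewrite covarianceE //; last by apply/Lfun1_integrable; rewrite e; exact: hA.1.
rewrite e unlock (has_mean_int h0) mul0e sube0.
by rewrite (has_mean_int hA).
Qed.

End transfer.

(** With [r = b / a], the square is expanded to [c - 2 r b + r^2 a], an identity valid even where
    the denominator vanishes; only the passage to the limit divides by [A]. *)
Lemma residual_variance_limit (R : realType) (x : nat -> R) (A B : R) : A != 0 ->
  n%:R^-1 * \sum_(i < n) x i ^+ 2 @[n --> \oo] --> A ->
  n%:R^-1 * \sum_(i < n) x i * x i.+1 @[n --> \oo] --> B ->
  n%:R^-1 * \sum_(i < n) x i.+1 ^+ 2 @[n --> \oo] --> A ->
  n%:R^-1 * \sum_(i < n) (x i.+1 -
     (\sum_(j < n) x j * x j.+1) / (\sum_(j < n) x j ^+ 2) * x i) ^+ 2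
    @[n --> \oo] --> (1 - (B / A) ^+ 2) * A.
Proof.
move=> A0 hA hB hC.
pose a n : R := n%:R^-1 * \sum_(i < n) x i ^+ 2.
pose b n : R := n%:R^-1 * \sum_(i < n) x i * x i.+1.
pose c n : R := n%:R^-1 * \sum_(i < n) x i.+1 ^+ 2.
have -> : (1 - (B / A) ^+ 2) * A = A - 2 * (B / A * B) + (B / A) * (B / A) * A by field.
have hr : b n / a n @[n --> \oo] --> B / A by apply: cvgM hB _; exact: cvgV.
have : c n - 2 * (b n / a n * b n) + (b n / a n) * (b n / a n) * a n @[n --> \oo] -->
    A - 2 * (B / A * B) + (B / A) * (B / A) * A.
  apply: cvgD; last by apply: cvgM hA; exact: cvgM.
  by apply: cvgB => //; apply: cvgM; [exact: cvg_cst|exact: cvgM].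
apply: cvg_trans; apply: near_eq_cvg; near=> n.
have n0 : (n%:R : R) != 0.
  by rewrite pnatr_eq0 -lt0n; near: n; exact: nbhs_infty_gt.
have -> : b n / a n = (\sum_(j < n) x j * x j.+1) / (\sum_(j < n) x j ^+ 2).
  by rewrite /a /b invfM invrK mulrACA mulVf // mul1r.
set r := _ / _.
rewrite (eq_bigr (fun i : 'I_n => x i.+1 ^+ 2 - 2 * r * (x i * x i.+1) + r * r * x i ^+ 2)).
  by rewrite big_split sumrB /= -!mulr_sumr /a /b /c; ring.
by move=> i _; ring.
Unshelve. all: by end_near. Qed.

Theorem theorem3p4 (d : measure_display) (T : measurableType d) (R : realType)
    (P : probability T R) (theta alpha : R)
    (eps eta X : int -> {RV P >-> R})
    (hX : causal_solution theta alpha eps eta X)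
    (* (i) *)
    (heps : strong_white_noise eps) (heta : strong_white_noise eta)
    (hindep : independent_processes eps eta)
    (hlneps : (\int[P]_w maxe (lne (`|eps 0 w|%:E)) 0 < +oo)%E)
    (hlntheta :
      (\int[P]_w lne (`|(theta + alpha * eta 0 w + eta 1 w)%R|%:E) < 0)%E)
    (* (ii) *)
    (hoddeps : odd_moments_vanish (eps 0))
    (hoddeta : odd_moments_vanish (eta 0))
    (* (iii) *)
    (hsigma2_gt0 : (0 < moment (eps 0%R) 2)%E)
    (htau2_gt0 : (0 < moment (eta 0%R) 2)%E)
    (hsigma2_fin : (moment (eps 0%R) 2 < +oo)%E)
    (htau4_fin : (moment (eta 0%R) 4 < +oo)%E)
    (hrho : spectral_radius (mxM theta alpha (fine (moment (eta 0) 2))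
                                 (fine (moment (eta 0) 4))) < 1)
    (hne : 2 * alpha * fine (moment (eta 0) 2) != 1) :
  let theta_star := theta / (1 - 2 * alpha * fine (moment (eta 0) 2)) in
  let sigma2_star := (1 - theta_star ^+ 2) * autocovariance X 0 in
  {ae P, forall w : T, sigma2_hat X n w @[n --> \oo] --> sigma2_star}.
Proof.
move: hrho hne; set tau2 := fine (moment (eta 0) 2).
set tau4 := fine (moment (eta 0) 4) => hrho hne theta_star sigma2_star.
pose sigma2 := fine (moment (eps 0) 2).
pose mu := noise_law eps eta; pose W := joint_noise eps eta.
have mW : measurable_fun setT W := measurable_joint_noise eps eta.
have indep := noise_law_indep heps heta hindep.
have stat := noise_law_stat heps heta.
pose mom j := nth 0 [:: 1; 0; tau2; 0; tau4] j.
have toT (f : coord_space (bool * int)%type R -> R) m : measurable_fun setT f ->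
    has_mean P (f \o W) m <-> has_mean mu f m.
  have pW A : measurable A -> P (W @^-1` A) = mu A by [].
  by move=> mf; have := has_mean_preserving m mW pW mf.
have heta4 : has_mean P (fun w => eta 0 w ^+ 4) tau4 by exact: moment_has_mean.
have heta_int j : (j <= 4)%N ->
    has_mean P (fun w => eta 0 w ^+ j) (\int[P]_w (eta 0 w ^+ j)).
  move=> j4; apply: (has_mean_dom _ _ (has_meanD (has_mean_cst P 1) heta4)).
    by apply: measurable_funX; exact: measurable_funP.
  by move=> w; exact: normrX_le_1Dexp4.
have hetaP j : (j <= 4)%N -> has_mean P (fun w => eta 0 w ^+ j) (mom j).
  case: j => [|[|[|[|[|j]]]]] // j4.
  - exact: has_mean_cst.
  - exact: (odd_moment_has_mean (k := 0) hoddeta (heta_int 1%N isT)).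
  - by have [i _] := heta_int 2%N isT; split => //; rewrite /mom /tau2 /moment unlock.
  - exact: (odd_moment_has_mean (k := 1) hoddeta (heta_int 3%N isT)).
have hmu_eta j : (j <= 4)%N -> has_mean mu (fun z => z (true, 0) ^+ j) (mom j).
  move=> j4; apply/toT; last exact: hetaP.
  by apply: measurable_funX; exact: measurable_coord.
have heps2P : has_mean P (fun w => eps 0 w ^+ 2) sigma2 by exact: moment_has_mean.
have heps1P : has_mean P (fun w => eps 0 w) 0.
  have h : has_mean P (fun w => eps 0 w ^+ (2 * 0 + 1)) (\int[P]_w (eps 0 w ^+ (2 * 0 + 1))).
    apply: (has_mean_dom _ _ (has_meanD (has_mean_cst P 1) heps2P)).
      by apply: measurable_funX; exact: measurable_funP.
    by move=> w; exact: normr_le_1Dsqr.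
  exact: odd_moment_has_mean hoddeps h.
have hmu_eps2 : has_mean mu (fun z => z (false, 0) ^+ 2) sigma2.
  by apply/toT => //; apply: measurable_funX; exact: measurable_coord.
have hmu_eps1 : has_mean mu (fun z => z (false, 0)) 0.
  by apply/toT => //; exact: measurable_coord.
have sigma2_gt0 : 0 < sigma2.
  by rewrite fine_gt0 // hsigma2_gt0.
pose F := @causal_limit R theta alpha.
have mF : measurable_fun setT F := measurable_causal_limit theta alpha.
have hF0 : has_mean mu F 0 := (causal_limit_cvg indep stat hmu_eta hmu_eps1 hmu_eps2 hrho).2.
have [A [A0 hA hB]] :=
  causal_limit_autocovariance indep stat hmu_eta hmu_eps1 hmu_eps2 hrho sigma2_gt0 hne.
pose tau := @shift _ R time_shift.
have XF : {ae P, forall w, forall n : nat, X n%:Z w = F (iter n tau (W w))}.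
  apply: ae_foralln => n; apply: filterS (hX.2 n%:Z) => w hw.
  (* Both sequences are read from index 1 on: there the empty or partial sum from [k = 1] together
     with the isolated [eps] term is exactly [psum], whereas at index 0 they differ. *)
  apply/esym/seq_limitE; rewrite -(cvg_shiftS (fun m => psum theta alpha m 0 _)) /=.
  move: hw; rewrite -(cvg_shiftS (fun m => _ + _)) /=; apply: cvg_trans.
  apply: near_eq_cvg; apply: nearW => m.
  rewrite psum_iter_shift /psum big_ord_recl term0 big_add1 /= big_mkord.
  by congr (_ + _).
have autocov : autocovariance X 0 = A.
  have X0F : {ae P, forall w, (F \o W) w = X 0 w}.
    by apply: filterS XF => w /(_ 0%N).
  apply: autocovariance_centered.
    by apply: has_mean_ae X0F _; [exact: measurable_funP|apply/toT].
  apply: (has_mean_ae (f := (fun z => F z ^+ 2) \o W)).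
  - by apply: measurable_funX; exact: measurable_funP.
  - by apply: filterS X0F => w /= ->.
  - by apply/toT => //; exact: measurable_funX.
have mtau : measurable_fun setT tau := @measurable_time_shift R.
have ptau := time_shift_preserving indep stat.
have ergodic := shift_ergodic indep time_shiftK stat time_shift_wandering.
have sample f m : has_mean mu f m ->
    {ae P, forall w, n%:R^-1 * \sum_(i < n) f (iter i tau (W w)) @[n --> \oo] --> m}.
  (* The null set given by Birkhoff's theorem lives on the trajectory space; its preimage under [W]
     is null because [mu] is the law of [W]. *)
  move=> [fi <-]; have [N [mN N0 subN]] := birkhoff mtau ptau ergodic fi.
  exists (W @^-1` N); split => //.
    by rewrite -[X in measurable X]setTI; exact: mW.
  by move=> w /= h; apply: (subN (W w)).
have hC : has_mean mu (fun z => F (tau z) ^+ 2) A.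
  by apply: ((mean_shift indep stat _ _).2 hA); exact: measurable_funX.
apply: filterS2 (filterI XF (sample _ _ hA)) (filterI (sample _ _ hB) (sample _ _ hC)).
move=> w [XFw wA] [wB wC].
pose x n := X n%:Z w.
have sig n : sigma2_hat X n w = n%:R^-1 * \sum_(i < n) (x i.+1 -
     (\sum_(j < n) x j * x j.+1) / (\sum_(j < n) x j ^+ 2) * x i) ^+ 2.
  have pred (i : nat) : i.+1%:Z - 1 = i%:Z by rewrite intS addrAC subrr add0r.
  rewrite /sigma2_hat big_add1 big_mkord; congr (_ * _); apply: eq_bigr => i _.
  rewrite /residual pred /theta_hat !big_add1 !big_mkord.
  congr ((_ - _ / _ * _) ^+ 2); apply: eq_bigr => j _; by rewrite pred.
under eq_fun do rewrite sig.
(* [theta_star] is put in the form gamma(1) / gamma(0), with [theta_star * A] the lag-one mean found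
   above. *)
have -> : sigma2_star = (1 - (theta_star * A / A) ^+ 2) * A.
  by rewrite /sigma2_star autocov mulfK // gt_eqF.
apply: residual_variance_limit; first by rewrite gt_eqF.
- apply: cvg_trans wA; apply: near_eq_cvg; apply: nearW => n.
  by congr (_ * _); apply: eq_bigr => i _; rewrite /x XFw.
- apply: cvg_trans wB; apply: near_eq_cvg; apply: nearW => n.
  by congr (_ * _); apply: eq_bigr => i _; rewrite /x !XFw.
- apply: cvg_trans wC; apply: near_eq_cvg; apply: nearW => n.
  by congr (_ * _); apply: eq_bigr => i _; rewrite /x XFw.
Qed.
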